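(* For every $n\in\omega$: if every $\Delta^1_n$ set of reals is Lebesgue measurable, then $\Delta^1_n(\mathcal{PFS})$ holds. Furthermore, if every $\Sigma^1_n$ set of reals is Lebesgue measurable, then every function $f:(\omega^\omega)^m\to\omega^\omega$ ($m\ge1$) whose graph $\{(x,f(x)):x\in(\omega^\omega)^m\}$ is a $\Pi^1_n$ set has a perfect free subset.
   Context: All projective classes are boldface. For a function $f:X^m\to X$ (with $X=2^\omega$ or $\omega^\omega$), a set $A\subseteq X$ is free for $f$ if for all $(a_0,\dots,a_{m-1})\in A^m$ we have $f(a_0,\dots,a_{m-1})\in\{a_0,\dots,a_{m-1}\}\cup(X\setminus A)$; a perfect free subset is a nonempty closed set without isolated points which is free for $f$. A function is a $\Delta^1_n$-function if preimages of open sets are $\Delta^1_n$. $\Delta^1_n(\mathcal{PFS})$ means: for every $m\ge1$, every $\Delta^1_n$-function $f:(2^\omega)^m\to 2^\omega$ has a perfect free subset. *)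

(* Defs.v *)
From HB Require Import structures.
From mathcomp Require Import all_boot all_order all_algebra.
From mathcomp Require Import all_classical all_reals all_analysis.
Set Implicit Arguments. Unset Strict Implicit. Unset Printing Implicit Defensive.
Import Order.TTheory GRing.Theory Num.Theory.
Local Open Scope classical_set_scope.

Definition baire_space : Type := prod_topology (fun _ : nat => nat).
HB.instance Definition _ := Pointed.on baire_space.
HB.instance Definition _ := Nbhs.on baire_space.
HB.instance Definition _ := Topological.on baire_space.

Definition fpow (X : topologicalType) (m : nat) : Type :=
  prod_topology (fun _ : 'I_m => X).
HB.instance Definition _ (X : ptopologicalType) m := Pointed.on (fpow X m).
HB.instance Definition _ (X : topologicalType) m := Nbhs.on (fpow X m).
HB.instance Definition _ (X : topologicalType) m := Topological.on (fpow X m).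

(** Boldface projective pointclasses, uniformly on every topological space X.
    Convention: Sigma^1_0 = open sets; Pi^1_n = complements of Sigma^1_n;
    Sigma^1_(n+1)(X) = projections along omega^omega of Pi^1_n subsets of
    X * omega^omega (so Sigma^1_1 = projections of closed sets). *)
Fixpoint Sigma1 (n : nat) : forall X : topologicalType, set X -> Prop :=
  match n with
  | 0 => fun X A => open A
  | n'.+1 => fun X A =>
      exists C : set (X * baire_space)%type,
        Sigma1 n' (~` C) /\ A = fst @` C
  end.

Definition Pi1 (n : nat) (X : topologicalType) (A : set X) : Prop :=
  Sigma1 n (~` A).

Definition Delta1 (n : nat) (X : topologicalType) (A : set X) : Prop :=
  Sigma1 n A /\ Pi1 n A.

Definition Delta1_fun (n : nat) (X Y : topologicalType) (f : X -> Y) : Prop :=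
  forall U : set Y, open U -> Delta1 n (f @^-1` U).

(** Lebesgue measurability of a set of reals: it belongs to the completion of
    the Borel sigma-algebra w.r.t. Lebesgue measure. *)
Definition lebesgue_measurable (R : realType) (A : set R) : Prop :=
  exists B : set R, measurable B /\
    (@lebesgue_measure R).-negligible ((A `\` B) `|` (B `\` A)).

Definition free_for (X : topologicalType) (m : nat) (f : fpow X m -> X)
    (A : set X) : Prop :=
  forall a : fpow X m, (forall i : 'I_m, A (a i)) ->
    (exists i : 'I_m, f a = a i) \/ ~ A (f a).

Definition has_perfect_free_subset (X : topologicalType) (m : nat)
    (f : fpow X m -> X) : Prop :=
  exists P : set X,
    [/\ P !=set0, closed P, isolated P = set0 & free_for f P].

Definition Delta1_PFS (n : nat) : Prop :=
  forall (m : nat), (1 <= m)%N ->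
    forall f : fpow cantor_space m -> cantor_space,
      Delta1_fun n f -> has_perfect_free_subset f.

Definition fgraph_set (X Y : Type) (f : X -> Y) : set (X * Y)%type :=
  [set p | p.2 = f p.1].

(* Main.v *)
Require Import Defs.
From HB Require Import structures.
From mathcomp Require Import all_boot all_order all_algebra.
From mathcomp Require Import all_classical all_reals all_analysis.
From mathcomp Require Import measurable_realfun lra ring.
Set Implicit Arguments. Unset Strict Implicit. Unset Printing Implicit Defensive.
Import Order.TTheory GRing.Theory Num.Theory.
Import numFieldTopology.Exports.
Local Open Scope classical_set_scope.

(** Only the graph of [f] has to be measurable, [f] itself need not be. Code a
    tuple of [m + 1] points of [2 ^ omega] by interleaving. The set of codes with
    [f (x_s1, .., x_sm) = x_j], where [j] is none of the [si], is disjoint from its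
    image under flipping any bit of [x_j]; since flips of late bits hardly move a
    closed set, such a set is null as soon as it is measurable. Measurability on
    [2 ^ omega] is reduced to measurability on the reals by an embedding of
    [2 ^ omega] as a Cantor set of positive Lebesgue measure, and tuples in
    [omega ^ omega] are taken from the copy of [2 ^ omega] inside it.

    It remains to find a perfect set all of whose tuples of distinct points avoid
    a given null set that is invariant under finite modifications. A random binary
    tree that branches slowly enough works almost surely. Its branches are
    independent random reals from their splitting point on. Cover every point of
    the null set infinitely often by clopen sets [Q_p] and let the tree branch so
    slowly that [Q_p] only sees the nodes of height at most [p]; as the [Q_p] can
    be chosen much smaller than the inverse of the number of tuples of such nodes,
    Borel-Cantelli applies. *)

(** * Projective sets *)

Section continuity.

Lemma continuous_into_prod (T : topologicalType) (I : Type)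
    (K : I -> topologicalType) (f : T -> prod_topology K) :
  (forall i, continuous (fun x => f x i)) -> continuous f.
Proof.
by move=> cf x; apply/cvg_sup => i; apply: continuous_comp_initial => y; exact: cf.
Qed.

Lemma continuous_coord (I : eqType) (K : I -> topologicalType) (i : I) :
  continuous (fun x : prod_topology K => x i).
Proof. exact: proj_continuous. Qed.

Lemma continuous_pair (T U V : topologicalType) (f : T -> U) (g : T -> V) :
  continuous f -> continuous g -> continuous (fun x => (f x, g x)).
Proof. by move=> cf cg x; apply: cvg_pair; [exact: cf|exact: cg]. Qed.

Lemma continuous_compose (T U V : topologicalType) (f : T -> U) (g : U -> V) :
  continuous f -> continuous g -> continuous (fun x => g (f x)).
Proof. by move=> cf cg x; apply: continuous_comp; [exact: cf|exact: cg]. Qed.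

Lemma continuous_fst (T U : topologicalType) : continuous (@fst T U).
Proof. by move=> x; exact: cvg_fst. Qed.

Lemma continuous_snd (T U : topologicalType) : continuous (@snd T U).
Proof. by move=> x; exact: cvg_snd. Qed.

Lemma open_preimage_continuous (T U : topologicalType) (f : T -> U) (A : set U) :
  continuous f -> open A -> open (f @^-1` A).
Proof. by move=> /continuousP; exact. Qed.

End continuity.

Section projective.

Lemma Sigma1_preimage (n : nat) (X Y : topologicalType) (g : X -> Y)
    (A : set Y) : continuous g -> Sigma1 n A -> Sigma1 n (g @^-1` A).
Proof.
elim: n X Y g A => [|n IHn] X Y g A cg /=.
  by move=> oA; move/continuousP : cg; exact.
move=> [C [SC ->]].
pose h (p : X * baire_space) := (g p.1, p.2).
have ch : continuous h.
  apply: continuous_pair; last exact: continuous_snd.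
  by apply: continuous_compose => //; exact: continuous_fst.
exists (h @^-1` C); split; first exact: (IHn _ _ h (~` C)).
apply/seteqP; split => x /=.
  by move=> [[y b] /= Cyb yx]; exists (x, b) => //=; rewrite /h/= -yx.
by move=> [[y b] /= Cyb <-]; exists (g y, b).
Qed.

Definition baire_even (y : baire_space) : baire_space := fun n => y n.*2.
Definition baire_odd (y : baire_space) : baire_space := fun n => y n.*2.+1.
Definition baire_merge (y z : baire_space) : baire_space :=
  fun n => if odd n then z n./2 else y n./2.

Lemma baire_even_merge y z : baire_even (baire_merge y z) = y.
Proof. by apply: funext => n; rewrite /baire_even /baire_merge odd_double doubleK. Qed.

Lemma baire_odd_merge y z : baire_odd (baire_merge y z) = z.
Proof. by apply: funext => n; rewrite /baire_odd /baire_merge /= odd_double uphalf_double. Qed.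

Lemma continuous_baire_even : continuous baire_even.
Proof. by apply: continuous_into_prod => i; exact: continuous_coord. Qed.

Lemma continuous_baire_odd : continuous baire_odd.
Proof. by apply: continuous_into_prod => i; exact: continuous_coord. Qed.

(** The two closure properties feed each other through complements, so a single induction proves
    both. For the intersection, the even and odd parts of one point of [baire_space] carry a witness
    for each set. *)
Lemma Sigma1_UI (n : nat) (X : topologicalType) (A B : set X) :
  Sigma1 n A -> Sigma1 n B -> Sigma1 n (A `|` B) /\ Sigma1 n (A `&` B).
Proof.
elim: n X A B => [|n IHn] X A B /=.
  by move=> oA oB; split; [exact: openU|exact: openI].
move=> [C [SC ->]] [D [SD ->]]; split.
  exists (C `|` D); split; last by rewrite image_setU.
  by rewrite setCU; apply: (IHn _ _ _ SC SD).2.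
pose g (p : X * baire_space) := (p.1, baire_even p.2).
pose h (p : X * baire_space) := (p.1, baire_odd p.2).
have cg : continuous g.
  apply: continuous_pair; first exact: continuous_fst.
  by apply: continuous_compose; [exact: continuous_snd|exact: continuous_baire_even].
have ch : continuous h.
  apply: continuous_pair; first exact: continuous_fst.
  by apply: continuous_compose; [exact: continuous_snd|exact: continuous_baire_odd].
exists (g @^-1` C `&` h @^-1` D); split.
  rewrite setCI; apply: (IHn _ _ _ _ _).1.
    exact: (Sigma1_preimage cg SC).
  exact: (Sigma1_preimage ch SD).
apply/seteqP; split => x /=.
  move=> [[[y b] /= Cb yx] [[z c] /= Dc zx]]; exists (x, baire_merge b c) => //.
  by rewrite /g /h /= baire_even_merge baire_odd_merge -{1}yx -zx.
by move=> [[y b] /= [Cb Db] <-]; split; [exists (g (y, b))|exists (h (y, b))].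
Qed.

Lemma Sigma1U (n : nat) (X : topologicalType) (A B : set X) :
  Sigma1 n A -> Sigma1 n B -> Sigma1 n (A `|` B).
Proof. by move=> SA SB; exact: (Sigma1_UI SA SB).1. Qed.

Lemma Sigma1I (n : nat) (X : topologicalType) (A B : set X) :
  Sigma1 n A -> Sigma1 n B -> Sigma1 n (A `&` B).
Proof. by move=> SA SB; exact: (Sigma1_UI SA SB).2. Qed.

Lemma Delta1_preimage (n : nat) (X Y : topologicalType) (g : X -> Y)
    (A : set Y) : continuous g -> Delta1 n A -> Delta1 n (g @^-1` A).
Proof.
move=> cg [SA PA]; split; first exact: Sigma1_preimage.
exact: (Sigma1_preimage cg PA).
Qed.

Lemma Delta1C (n : nat) (X : topologicalType) (A : set X) :
  Delta1 n A -> Delta1 n (~` A).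
Proof. by move=> [SA PA]; split => //; rewrite /Pi1 setCK. Qed.

Lemma Delta1I (n : nat) (X : topologicalType) (A B : set X) :
  Delta1 n A -> Delta1 n B -> Delta1 n (A `&` B).
Proof.
move=> [SA PA] [SB PB]; split; first exact: Sigma1I.
by rewrite /Pi1 setCI; exact: Sigma1U.
Qed.

Lemma Delta1U (n : nat) (X : topologicalType) (A B : set X) :
  Delta1 n A -> Delta1 n B -> Delta1 n (A `|` B).
Proof.
move=> [SA PA] [SB PB]; split; first exact: Sigma1U.
by rewrite /Pi1 setCU; exact: Sigma1I.
Qed.

Lemma Delta1_clopen0 (X : topologicalType) (A : set X) :
  Delta1 0 A <-> clopen A.
Proof.
rewrite /Delta1 /Pi1 /clopen /=; split => -[oA]; first by rewrite openC.
by move=> cA; split; rewrite ?openC.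
Qed.

Lemma closed_Sigma1_1 (X : topologicalType) (A : set X) :
  closed A -> Sigma1 1 A.
Proof.
move=> cA /=; exists (fst @^-1` A); split.
  rewrite openC; apply: preimage_closed => // x _.
  exact: continuous_fst.
apply/seteqP; split => [x Ax|x [[y b] /= Ay <-//]].
by exists (x, point).
Qed.

(** The first entry of the witness names the index of a closed set containing the point. *)
Lemma bigcup_closed_Sigma1_1 (X : topologicalType) (F : nat -> set X) :
  (forall i, closed (F i)) -> Sigma1 1 (\bigcup_i F i).
Proof.
move=> cF /=; exists [set p | F (p.2 0%N) p.1]; split.
  have -> : ~` [set p | F (p.2 0%N) p.1] =
      \bigcup_i ((fun p : X * baire_space => p.1) @^-1` (~` F i) `&`
       (fun p : X * baire_space => (p.2 : baire_space) 0%N) @^-1` [set i]).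
    apply/seteqP; split => [[x b] /= nF|[x b] [i _ [nF bi]]].
      by exists (b 0%N).
    by have {bi}bi : b 0%N = i by []; rewrite /= bi.
  apply: bigcup_open => i _; apply: openI.
    apply: open_preimage_continuous; first exact: (@continuous_fst X baire_space).
    by rewrite openC.
  apply: open_preimage_continuous; last exact: discrete_open.
  exact: (continuous_compose (@continuous_snd X baire_space)
    (@continuous_coord _ (fun=> nat) 0%N)).
apply/seteqP; split => [x [i _ Fx]|x [[y b] /= Fy <-]].
  by exists (x, fun=> i).
by exists (b 0%N).
Qed.

(** The metric enters here: an open set is the countable union of the closed sets [F i] of points at
    distance at least [1 / (i + 1)] from its complement. *)
Lemma open_Sigma1_1 (R : realType) (U : set R) : open U -> Sigma1 1 U.
Proof.
move=> oU.
pose F i := ~` \bigcup_(y in ~` U) ball y (i.+1%:R^-1 : R)%R.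
have -> : U = \bigcup_i F i.
  apply/seteqP; split => [x Ux|x [i _ nF]]; last first.
    apply: contrapT => nU; apply: nF; exists x => //.
    exact: ballxx.
  have [e /= e0 xeU] := (nbhs_ballP x U).1 (open_nbhs_nbhs (conj oU Ux)).
  have [i ie] : exists i : nat, (i.+1%:R^-1 < e)%R.
    have [i _ Hi] := near_infty_natSinv_lt (PosNum e0).
    by exists i; exact: (Hi i (leqnn i)).
  exists i => // -[y nUy /ball_sym yx]; apply: nUy; apply: xeU.
  by apply: le_ball yx; exact: ltW.
apply: bigcup_closed_Sigma1_1 => i; apply: open_closedC.
by apply: bigcup_open => y _; exact: ball_open.
Qed.

Lemma Delta1_succ (n : nat) (X : topologicalType) (A : set X) :
  Delta1 n A -> Delta1 n.+1 A.
Proof.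
have sub (B : set X) : Delta1 n B -> Sigma1 n.+1 B.
  move=> [SB PB]; exists (fst @^-1` B); split.
    by apply: (Sigma1_preimage _ PB); exact: continuous_fst.
  apply/seteqP; split => [x Bx|x [[y b] /= By <-//]].
  by exists (x, point).
by move=> DA; split; [exact: sub|apply: sub; exact: Delta1C].
Qed.

Lemma open_Delta1 (R : realType) (n : nat) (U : set R) :
  open U -> Delta1 n.+1 U.
Proof.
move=> oU; elim: n => [|n]; last exact: Delta1_succ.
split; first exact: open_Sigma1_1.
by apply: closed_Sigma1_1; exact: open_closedC.
Qed.

(** * Images of projective sets under a continuous injection of the Cantor space *)

Definition cantor_baire (x : cantor_space) : baire_space := fun n => nat_of_bool (x n).
(** A left inverse of [cantor_baire], by which a witness in [baire_space] can encode a point of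
    [cantor_space]. *)
Definition baire_cantor (y : baire_space) : cantor_space := fun n => y n != 0%N.

Lemma cantor_baireK : cancel cantor_baire baire_cantor.
Proof.
by move=> x; apply: funext => n; rewrite /baire_cantor /cantor_baire; case: (x n).
Qed.

Lemma continuous_from_discrete (D : discreteTopologicalType)
    (T : topologicalType) (f : D -> T) : continuous f.
Proof. by apply/continuousP => A _; exact: discrete_open. Qed.

Lemma continuous_cantor_baire : continuous cantor_baire.
Proof.
apply: continuous_into_prod => i.
apply: (continuous_compose (@continuous_coord _ (fun=> bool) i)
  (@continuous_from_discrete _ _ nat_of_bool)).
Qed.

Lemma continuous_baire_cantor : continuous baire_cantor.
Proof.
apply: continuous_into_prod => i.
apply: (continuous_compose (@continuous_coord _ (fun=> nat) i)
  (@continuous_from_discrete _ _ (fun k => k != 0%N))).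
Qed.

Variables (R : realType) (psi : cantor_space -> R).
Hypotheses (cpsi : continuous psi) (ipsi : injective psi).

(** One witness encodes both a point that [psi] sends to the given real and a witness that this
    point lies in [A]; the equation between the reals is a closed condition. *)
Lemma Sigma1_image (n : nat) (A : set cantor_space) :
  Sigma1 n.+1 A -> Sigma1 n.+1 (psi @` A).
Proof.
move=> [C [SC ->]].
pose g (p : R * baire_space) := baire_cantor (baire_even p.2).
have cg : continuous g.
  apply: continuous_compose; last exact: continuous_baire_cantor.
  apply: continuous_compose; last exact: continuous_baire_even.
  exact: continuous_snd.
pose h p := (g p, baire_odd p.2).
have ch : continuous h.
  apply: continuous_pair => //.
  apply: continuous_compose; last exact: continuous_baire_odd.
  exact: continuous_snd.
pose d p := (psi (g p) - p.1)%R.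
have cd : continuous d.
  move=> p; apply: cvgB; last exact: continuous_fst.
  exact: (continuous_compose cg cpsi).
exists (d @^-1` [set 0%R] `&` h @^-1` C); split.
  rewrite setCI; apply: Sigma1U; last exact: (Sigma1_preimage ch SC).
  have o0 : open (~` [set 0%R : R]) by rewrite openC; exact: closed_eq.
  apply: (Sigma1_preimage (A := ~` [set 0%R])) => //.
  (* At level 0 the complement of a point only has to be open; every level from 1 on contains the
     open sets of reals. *)
  by case: n SC => [|n] _; [|exact: (open_Delta1 n o0).1].
apply/seteqP; split => [r [x [[y b] /= Cyb <-] <-]|r [[s b] /= [E Cs] <-]].
  exists (psi y, baire_merge (cantor_baire y) b) => //=.
  by rewrite /d /h /g /= baire_even_merge baire_odd_merge cantor_baireK subrr.
have /eqP : (psi (g (s, b)) - s = 0)%R by exact: E.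
rewrite subr_eq0 => /eqP <-.
by exists (g (s, b)) => //; exists (h (s, b)).
Qed.

Lemma compact_image_cantor (A : set cantor_space) :
  closed A -> compact (psi @` A).
Proof.
move=> cA; apply: continuous_compact.
  by apply: continuous_subspaceT.
by apply: (subclosed_compact cA cantor_space_compact).
Qed.

(** By injectivity the complement of the image is the image of the complement together with the open
    complement of the compact range. *)
Lemma Delta1_image (n : nat) (A : set cantor_space) :
  Delta1 n.+1 A -> Delta1 n.+1 (psi @` A).
Proof.
move=> [SA PA]; split; first exact: Sigma1_image.
rewrite /Pi1.
have -> : ~` (psi @` A) = ~` (psi @` setT) `|` psi @` (~` A).
  apply/seteqP; split => [r nA|r [nT|[x nAx <-]]].
  - have [[x _ xr]|nT] := pselect ((psi @` setT) r); last by left.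
    by right; exists x => // Ax; apply: nA; exists x.
  - by move=> [x Ax xr]; apply: nT; exists x.
  - by move=> [y Ay /ipsi yx]; apply: nAx; rewrite -yx.
apply: Sigma1U; last exact: Sigma1_image.
apply: (open_Delta1 _ _).1; rewrite openC.
apply: compact_closed; first exact: Rhausdorff.
exact: compact_image_cantor.
Qed.

End projective.

(** * A Cantor set of positive measure *)

Section fat_cantor.
Variable R : realType.
Local Open Scope ring_scope.

(* The 2 ^ n pieces of level n are intervals of length [fat_tail n]; the term
   2^-n keeps their total length at least 1, the term 3^-n separates them. *)
Definition fat_tail (n : nat) : R := 2^-1 ^+ n + 3^-1 ^+ n.

(** The offset of the right half of a piece of level [n], chosen so that the two halves sit at the
    ends of the piece. The weights from [n] on telescope to [fat_tail n]. *)
Definition fat_weight (n : nat) : R := fat_tail n - fat_tail n.+1.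

Lemma fat_tail_gt0 n : 0 < fat_tail n.
Proof. by rewrite /fat_tail addr_gt0 // exprn_gt0 // invr_gt0 ltr0n. Qed.

Lemma fat_tail_lt_weight n : fat_tail n.+1 < fat_weight n.
Proof.
have : (0 : R) < 3^-1 ^+ n by rewrite exprn_gt0 // invr_gt0 ltr0n.
rewrite /fat_weight /fat_tail !exprS; lra.
Qed.

Lemma fat_weight_gt0 n : 0 < fat_weight n.
Proof. exact: lt_trans (fat_tail_gt0 n.+1) (fat_tail_lt_weight n). Qed.

Lemma fat_tail_cvg0 : fat_tail n @[n --> \oo] --> 0.
Proof.
rewrite -(addr0 0); apply: cvgD; apply: cvg_expr;
  rewrite ger0_norm ?invr_ge0 // invf_lt1 //; by rewrite ltr1n.
Qed.

Lemma fat_tail_ge n : 2^-1 ^+ n <= fat_tail n.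
Proof. by rewrite /fat_tail lerDl exprn_ge0 // invr_ge0. Qed.

Definition fat_sum (x : cantor_space) (n : nat) : R :=
  \sum_(0 <= i < n) (x i)%:R * fat_weight i.

Definition fat_cantor (x : cantor_space) : R := limn (fat_sum x).

Lemma fat_sumS x n : fat_sum x n.+1 = fat_sum x n + (x n)%:R * fat_weight n.
Proof. by rewrite /fat_sum big_nat_recr. Qed.

Lemma fat_sum_bounds x n k :
  fat_sum x n <= fat_sum x (n + k) <= fat_sum x n + fat_tail n - fat_tail (n + k).
Proof.
elim: k => [|k]; first by rewrite addn0; apply/andP; split; lra.
rewrite addnS fat_sumS => /andP[]; have := fat_weight_gt0 (n + k).
rewrite /fat_weight; case: (x _) => /=; rewrite ?mul1r ?mul0r;
  move=> *; apply/andP; split; lra.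
Qed.

Lemma fat_sum_nondecreasing x : nondecreasing_seq (fat_sum x).
Proof.
move=> m n /subnKC <-; by case/andP: (fat_sum_bounds x m (n - m)).
Qed.

Lemma fat_sum_cvg x : fat_sum x @ \oo --> fat_cantor x.
Proof.
apply: nondecreasing_is_cvgn; first exact: fat_sum_nondecreasing.
exists (fat_sum x 0 + fat_tail 0) => _ [n _ <-].
have /andP[_] := fat_sum_bounds x 0 n; rewrite add0n => h.
by apply: le_trans h _; rewrite gerBl; exact/ltW/fat_tail_gt0.
Qed.

Lemma fat_cantor_bounds x n :
  fat_sum x n <= fat_cantor x <= fat_sum x n + fat_tail n.
Proof.
apply/andP; split.
  apply: nondecreasing_cvgn_le; first exact: fat_sum_nondecreasing.
  by apply/cvg_ex; exists (fat_cantor x); exact: fat_sum_cvg.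
apply: limr_le; first by apply/cvg_ex; exists (fat_cantor x); exact: fat_sum_cvg.
exists n => // k /= /subnKC <-.
have /andP[_ h] := fat_sum_bounds x n (k - n).
by apply: le_trans h _; rewrite gerBl; exact/ltW/fat_tail_gt0.
Qed.

Lemma eq_fat_sum x y n : (forall i, (i < n)%N -> x i = y i) ->
  fat_sum x n = fat_sum y n.
Proof. by move=> xy; apply: eq_big_nat => i /andP[_ /xy ->]. Qed.

Lemma fat_cantor_dist x y n : (forall i, (i < n)%N -> x i = y i) ->
  `|fat_cantor x - fat_cantor y| <= fat_tail n.
Proof.
move=> /eq_fat_sum xy; have := fat_cantor_bounds x n.
have := fat_cantor_bounds y n; rewrite xy ler_norml.
by move=> /andP[? ?] /andP[? ?]; apply/andP; split; lra.
Qed.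

Lemma cantor_prefix_nbhs (x : cantor_space) n :
  nbhs x [set y : cantor_space | forall i, (i < n)%N -> x i = y i].
Proof.
elim: n => [|n IHn].
  by apply: (@filterS _ (nbhs x) _ setT) => //; exact: filterT.
have H : nbhs x [set y : cantor_space | y n = x n].
  exact: (@continuous_coord _ (fun=> bool) n x [set x n] (discrete_set1 (x n))).
apply: (@filterS2 _ (nbhs x) _ _ _ _ _ IHn H) => y IH yn i.
by rewrite ltnS leq_eqVlt => /predU1P[->//|]; exact: IH.
Qed.

Lemma continuous_fat_cantor : continuous fat_cantor.
Proof.
move=> x; apply/cvgrPdist_le => /= e e0.
have [n _ Hn] := (cvgrPdist_le _ _).1 fat_tail_cvg0 _ e0.
apply: (@filterS _ (nbhs x) _ _ _ _ (cantor_prefix_nbhs x n)) => y xy.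
apply: le_trans (fat_cantor_dist xy) _.
have := Hn n (leqnn n); rewrite /= sub0r normrN ger0_norm //.
exact/ltW/fat_tail_gt0.
Qed.

(** The weight of bit [n] exceeds the total of all later weights, so the map is strictly increasing
    for the lexicographic order. *)
Lemma fat_cantor_lt x y n : (forall i, (i < n)%N -> x i = y i) ->
  x n = false -> y n = true -> fat_cantor x < fat_cantor y.
Proof.
move=> /eq_fat_sum xy xn yn.
have := fat_cantor_bounds x n.+1; have := fat_cantor_bounds y n.+1.
have := fat_tail_lt_weight n.
rewrite !fat_sumS xy xn yn /= mul1r mul0r => ? /andP[? ?] /andP[? ?]; lra.
Qed.

Lemma fat_cantor_inj : injective fat_cantor.
Proof.
move=> x y exy; apply: contrapT => /eqP.
have [xy|] := pselect (forall n, x n = y n).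
  by rewrite (funext xy) eqxx.
move=> /existsNP[k /eqP nk] _.
have [n /eqP xyn min] := ex_minnP (ex_intro (fun n => x n != y n) k nk).
have eqn i : (i < n)%N -> x i = y i.
  by move=> ltin; apply/eqP; apply: contraTT ltin; rewrite -leqNgt; exact: min.
case xn : (x n); case yn : (y n).
- by rewrite xn yn in xyn.
- have := fat_cantor_lt (fun i li => esym (eqn i li)) yn xn.
  by rewrite exy ltxx.
- have := fat_cantor_lt eqn xn yn.
  by rewrite exy ltxx.
- by rewrite xn yn in xyn.
Qed.

Definition flip (p : nat) (x : cantor_space) : cantor_space :=
  fun n => if n == p then ~~ x n else x n.

Lemma flipK p : involutive (flip p).
Proof.
by move=> x; apply: funext => n; rewrite /flip; case: eqP => // _; rewrite negbK.
Qed.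

Lemma continuous_flip p : continuous (flip p).
Proof.
apply: continuous_into_prod => i.
apply: (continuous_compose (@continuous_coord _ (fun=> bool) i)
  (@continuous_from_discrete _ _ (fun b => if i == p then ~~ b else b))).
Qed.

(** On the image, flipping bit [p] is a translation; the flip invariance of the induced measure
    comes from this. *)
Lemma fat_cantor_flip p x : x p = false ->
  fat_cantor (flip p x) = fat_cantor x + fat_weight p.
Proof.
move=> xp.
have sumE n : (p < n)%N -> fat_sum (flip p x) n = fat_sum x n + fat_weight p.
  elim: n => // n IHn; rewrite ltnS leq_eqVlt => /predU1P[<-|pn].
    rewrite !fat_sumS /flip eqxx xp /= mul1r mul0r addr0.
    congr (_ + _); apply: eq_fat_sum => i ip.
    by rewrite ltn_eqF.
  by rewrite !fat_sumS (IHn pn) /flip gtn_eqF //; ring.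
apply: (@cvg_unique _ (@Rhausdorff R) (fat_sum (flip p x) @ \oo)).
  exact: fat_sum_cvg.
apply: (@cvg_trans _ ((fun n => fat_sum x n + fat_weight p) @ \oo)).
  apply: near_eq_cvg; exists p.+1 => // n /= pn; by rewrite sumE.
by apply: cvgD; [exact: fat_sum_cvg|exact: cvg_cst].
Qed.

End fat_cantor.

(** * The induced measure on the Cantor space *)

Section lebesgue_shift.
Variable R : realType.
Local Open Scope ereal_scope.

(** The pushforward along the translation agrees with Lebesgue measure on half-open intervals, hence
    everywhere by uniqueness. *)
Lemma lebesgue_measure_shift (t : R) (A : set R) : measurable A ->
  lebesgue_measure ((fun r => r + t)%R @^-1` A) = lebesgue_measure A.
Proof.
move=> mA.
have mt : measurable_fun [set: R] (fun r : R => r + t : measurableTypeR R)%R.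
  apply: continuous_measurable_fun => x.
  by apply: cvgD; [exact: cvg_id|exact: cvg_cst].
change (pushforward lebesgue_measure (fun r : R => r + t : measurableTypeR R)%R A
  = lebesgue_measure A).
apply/esym/lebesgue_measure_unique => //= _ [[a b]] _ <-.
rewrite /pushforward.
have -> : (fun r : R => r + t : measurableTypeR R)%R @^-1` `]a, b]%classic =
    `](a - t)%R, (b - t)%R]%classic :> set R.
  by apply/seteqP; split => r /=; rewrite !in_itv /= ltrBlDr lerBrDr.
rewrite !lebesgue_measure_itv /= !lte_fin ltrD2r.
by case: ifP => // _; rewrite -!EFinD; congr (_%:E); ring.
Qed.

End lebesgue_shift.

Definition cantorB := g_sigma_algebraType (@open cantor_space).
HB.instance Definition _ := Measurable.on cantorB.

Section fat_measure.
Variable R : realType.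
Local Open Scope ereal_scope.
Local Notation psi := (@fat_cantor R).

Lemma compact_fat_image (A : set cantor_space) :
  closed A -> compact (psi @` A).
Proof. exact/compact_image_cantor/continuous_fat_cantor. Qed.

(** Since [psi] is injective, the sets with measurable image form a sigma-algebra; it contains the
    closed sets, whose images are compact. *)
Lemma measurable_fat_image (A : set cantorB) :
  measurable A -> measurable (psi @` A).
Proof.
have imC (B : set cantor_space) : psi @` (setT `\` B) = psi @` setT `\` psi @` B.
  apply/seteqP; split => [_ [x [_ nBx] <-]|_ [[x _ <-] nB]].
    by split; [exists x|move=> [y By /fat_cantor_inj yx]; apply: nBx; rewrite -yx].
  by exists x => //; split => // Bx; apply: nB; exists x.
have mC (B : set cantor_space) : closed B -> measurable (psi @` B).
  move=> cB; apply: compact_measurable; exact: compact_fat_image.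
have mT : measurable (psi @` setT) by exact: mC.
apply: (smallest_sub (X := [set A : set cantorB | measurable (psi @` A)])); last first.
  move=> B oB /=; rewrite -(setCK B) -setTD imC; apply: measurableD => //.
  by apply: mC; exact: open_closedC.
split => /=.
- by rewrite image_set0.
- by move=> B mB; rewrite imC; exact: measurableD.
- move=> F mF; rewrite image_bigcup; exact: bigcupT_measurable.
Qed.

Definition fat_mass (A : set cantorB) : \bar R := lebesgue_measure (psi @` A).

Let fat_mass0 : fat_mass set0 = 0.
Proof. by rewrite /fat_mass image_set0 measure0. Qed.

Let fat_mass_ge0 A : 0 <= fat_mass A.
Proof. exact: measure_ge0. Qed.

Let fat_mass_sigma_additive : semi_sigma_additive fat_mass.
Proof.
move=> F mF tF mUF; rewrite /fat_mass image_bigcup.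
apply: measure_semi_sigma_additive.
- by move=> n; exact: measurable_fat_image.
- apply/trivIsetP => i j _ _ ij; apply/seteqP; split => // r.
  move=> [[x Fx <-] [y Fy /fat_cantor_inj yx]].
  move/trivIsetP : tF => /(_ i j I I ij) /seteqP[/(_ x) + _]; apply.
  by split => //; rewrite -yx.
- by rewrite -image_bigcup; exact: measurable_fat_image.
Qed.

HB.instance Definition _ := isMeasure.Build _ _ _ fat_mass
  fat_mass0 fat_mass_ge0 fat_mass_sigma_additive.

Lemma fat_mass_lty A : measurable A -> fat_mass A < +oo.
Proof.
move=> mA; apply: (@le_lt_trans _ _ (fat_mass setT)).
  by apply: le_measure => //; rewrite inE.
by apply: compact_finite_measure; exact: compact_fat_image.
Qed.

Lemma open_cantorB (A : set cantor_space) : open A -> measurable (A : set cantorB).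
Proof. by move=> oA; exact: sub_sigma_algebra. Qed.

Lemma closed_cantorB (A : set cantor_space) :
  closed A -> measurable (A : set cantorB).
Proof.
move=> cA; rewrite -(setCK A); apply: measurableC.
by apply: open_cantorB; rewrite openC.
Qed.

(** A piece of level [m], moved to the origin, after [n] rounds of removing middle gaps. The
    recursion splits the outermost piece first, so that its two halves are translates of each other
    and the measure doubles exactly. *)
Fixpoint fat_approx (n m : nat) : set R :=
  if n is n'.+1 then
    fat_approx n' m.+1 `|` (fun r => r - fat_weight R m)%R @^-1` fat_approx n' m.+1
  else `[0%R, fat_tail R m]%classic.

Lemma closed_fat_approx n m : closed (fat_approx n m).
Proof.
elim: n m => [|n IHn] m /=; first exact: interval_closed.
apply: closedU => //; apply: preimage_closed => // x _.
by apply: cvgB; [exact: cvg_id|exact: cvg_cst].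
Qed.

Lemma fat_approx_sub n m : fat_approx n m `<=` `[0%R, fat_tail R m]%classic.
Proof.
elim: n m => [m r //|n IHn m r /=].
have := fat_weight_gt0 R m; have := fat_tail_gt0 R m.+1.
have : (fat_tail R m = fat_weight R m + fat_tail R m.+1)%R.
  by rewrite /fat_weight; ring.
move=> e t0 a0 [/IHn /=|/IHn /=]; rewrite !in_itv /= => /andP[? ?]; lra.
Qed.

Lemma fat_approx_nonincreasing n m : fat_approx n.+1 m `<=` fat_approx n m.
Proof.
elim: n m => [|n IHn] m; first exact: fat_approx_sub.
by move=> r [/IHn|/IHn]; [left|right].
Qed.

Lemma fat_approx_mass n m :
  lebesgue_measure (fat_approx n m) = (2 ^+ n * fat_tail R (n + m))%:E.
Proof.
elim: n m => [|n IHn] m.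
  rewrite /= expr0 mul1r add0n lebesgue_measure_itv /= lte_fin fat_tail_gt0.
  by rewrite -EFinD subr0.
have mS k : measurable (fat_approx n k).
  by apply: (@closed_measurable R); exact: closed_fat_approx.
have sE : lebesgue_measure
    ((fun r => r - fat_weight R m)%R @^-1` fat_approx n m.+1) =
    lebesgue_measure (fat_approx n m.+1).
  by rewrite lebesgue_measure_shift.
have mS' : measurable ((fun r => r - fat_weight R m)%R @^-1` fat_approx n m.+1).
  apply: closed_measurable; apply: preimage_closed; last exact: closed_fat_approx.
  by move=> x _; apply: cvgB; [exact: cvg_id|exact: cvg_cst].
have disj (r : R) : fat_approx n m.+1 r ->
    fat_approx n m.+1 (r - fat_weight R m)%R -> False.
  move=> /fat_approx_sub + /fat_approx_sub; rewrite /= !in_itv /=.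
  by have := fat_tail_lt_weight R m; clear => ? /andP[? ?] /andP[? ?]; lra.
transitivity (lebesgue_measure (fat_approx n m.+1) + lebesgue_measure
    ((fun r => r - fat_weight R m)%R @^-1` fat_approx n m.+1)).
  apply: measureU; [exact: mS|exact: mS'|].
  by apply/seteqP; split => // r [h1 h2]; exact: disj h1 h2.
rewrite [X in _ + X = _]sE IHn -EFinD addnS addSn exprS; congr (_%:E); ring.
Qed.

(** The bits of [x] record in which half the point lies at each of the [n] rounds. *)
Lemma fat_approx_near n m r : fat_approx n m r ->
  exists x : cantor_space,
    (`|r - \sum_(0 <= i < n) (x i)%:R * fat_weight R (m + i)|
      <= fat_tail R (m + n))%R.
Proof.
elim: n m r => [|n IHn] m r /=.
  rewrite in_itv /= => /andP[? ?]; exists point.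
  by rewrite big_geq // subr0 addn0 ger0_norm.
case=> /IHn[x xr].
  exists (fun i => if i is i'.+1 then x i' else false).
  rewrite big_nat_recl //= mul0r add0r addnS -addSn.
  by under eq_bigr do rewrite addnS -addSn.
exists (fun i => if i is i'.+1 then x i' else true).
rewrite big_nat_recl //= mul1r addn0 opprD addrA addnS -addSn.
by under eq_bigr do rewrite addnS -addSn.
Qed.

(** A point of all approximations is a limit of points of the image, and the image is compact, hence
    closed. *)
Lemma bigcap_fat_approx : \bigcap_n fat_approx n 0 `<=` psi @` setT.
Proof.
move=> r Hr.
have : closed (psi @` setT).
  apply: compact_closed; first exact: Rhausdorff.
  exact: compact_fat_image.
apply => U /nbhs_ballP[e /= e0 rU].
have [n _ Hn] := (cvgrPdist_lt _ _).1 (@fat_tail_cvg0 R) _ (divr_gt0 e0 (ltr0n _ 2)).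
have := Hn n (leqnn n); rewrite /= sub0r normrN ger0_norm; last exact/ltW/fat_tail_gt0.
have [x] := fat_approx_near (Hr n I).
rewrite add0n (eq_bigr (fun i => (x i)%:R * fat_weight R i)%R) // => xr te.
exists (psi x); split; first by exists x.
apply: rU; rewrite /ball /=.
have := fat_cantor_bounds R x n; rewrite /fat_sum.
move: xr; rewrite !ltr_norml !ler_norml => /andP[? ?] /andP[? ?].
by apply/andP; split; lra.
Qed.

Lemma fat_mass_gt0 : 0 < fat_mass setT.
Proof.
(* The bound 1 survives in the limit, as the [n]-th approximation has measure
   [2 ^+ n * fat_tail R n], which is at least [2 ^+ n * 2^-1 ^+ n]. *)
apply: (@lt_le_trans _ _ 1) => //.
have mF n : measurable (fat_approx n 0).
  by apply: (@closed_measurable R); exact: closed_fat_approx.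
have mI : measurable (\bigcap_n fat_approx n 0).
  by apply: bigcapT_measurable.
apply: (@le_trans _ _ (lebesgue_measure (\bigcap_n fat_approx n 0))); last first.
  apply: le_measure; rewrite ?inE //; last exact: bigcap_fat_approx.
  exact: (measurable_fat_image measurableT).
have cvgF : lebesgue_measure \o fat_approx ^~ 0%N @ \oo -->
    lebesgue_measure (\bigcap_n fat_approx n 0).
  apply: nonincreasing_cvg_mu => //.
    rewrite [X in X < _](_ : _ = (2 ^+ 0 * fat_tail R (0 + 0))%:E) ?ltry //.
    exact: fat_approx_mass.
  apply/nonincreasing_seqP => n.
  by apply/subsetPset; exact: fat_approx_nonincreasing.
rewrite -(cvg_lim _ cvgF) //; apply: lime_ge; first exact: cvgP cvgF.
apply: nearW => n; change (1 <= lebesgue_measure (fat_approx n 0)).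
rewrite fat_approx_mass lee_fin addn0.
apply: (@le_trans _ _ (2 ^+ n * 2^-1 ^+ n)%R).
  by rewrite -exprMn mulfV // expr1n.
by rewrite ler_pM2l ?exprn_gt0 // fat_tail_ge.
Qed.

End fat_measure.

Lemma measurable_preimage_continuous (g : cantor_space -> cantor_space)
    (A : set cantorB) : continuous g -> measurable A ->
  measurable (g @^-1` A : set cantorB).
Proof.
move=> cg.
apply: (smallest_sub (X := [set A : set cantorB | measurable (g @^-1` A : set cantorB)])).
  split => /=.
  - by rewrite preimage_set0.
  - by move=> B mB; rewrite setTD preimage_setC; exact: measurableC.
  - by move=> F mF; rewrite preimage_bigcup; exact: bigcupT_measurable.
by move=> B oB /=; apply: open_cantorB; exact: open_preimage_continuous.
Qed.

(** * Sets determined by finitely many bits *)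

Definition prefix_set (n : nat) (Q : set cantor_space) :=
  forall x y : cantor_space, (forall i, (i < n)%N -> x i = y i) -> Q x -> Q y.

Lemma prefix_setC n Q : prefix_set n Q -> prefix_set n (~` Q).
Proof. by move=> pQ x y xy nQ Qy; apply: nQ; apply: pQ Qy => i /xy. Qed.

Lemma prefix_set_open n Q : prefix_set n Q -> open Q.
Proof.
move=> pQ; rewrite openE => x Qx.
apply: (@filterS _ (nbhs x) _ _ _ _ (cantor_prefix_nbhs x n)) => y xy.
exact: pQ xy Qx.
Qed.

Lemma prefix_set_closed n Q : prefix_set n Q -> closed Q.
Proof. by move=> /prefix_setC /prefix_set_open; rewrite openC. Qed.

Lemma prefix_set_measurable n Q : prefix_set n Q -> measurable (Q : set cantorB).
Proof. by move=> /prefix_set_open; exact: open_cantorB. Qed.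

Lemma prefix_setW m n Q : (m <= n)%N -> prefix_set m Q -> prefix_set n Q.
Proof. by move=> mn pQ x y xy; apply: pQ => i im; apply: xy; exact: leq_trans mn. Qed.

Lemma prefix_set_coord p b : prefix_set p.+1 [set x : cantor_space | x p = b].
Proof. by move=> x y xy /= <-; rewrite xy. Qed.

(** * Invariance of the measure under flipping and relabelling bits *)

Section mass.
Variable R : realType.
Local Open Scope ereal_scope.
Local Notation psi := (@fat_cantor R).
Local Notation mu := (@fat_mass R).

(** The flip exchanges the halves of the space given by bit [p], and on each half it acts on the
    image as a translation by plus or minus [fat_weight R p]. *)
Lemma fat_mass_flip (p : nat) (A : set cantorB) : measurable A ->
  mu (flip p @^-1` A) = mu A.
Proof.
move=> mA.
pose Cb b := [set x : cantor_space | x p = b].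
have mC b : measurable (Cb b : set cantorB).
  exact: prefix_set_measurable (@prefix_set_coord p b).
have split_mass (B : set cantorB) : measurable B ->
    mu B = mu (B `&` Cb false) + mu (B `&` Cb true).
  move=> mB; rewrite -measureU; [|exact: measurableI|exact: measurableI|].
  - congr fat_mass; apply/seteqP; split => [x Bx|x [[]//|[]//]].
    by case E : (x p); [right|left].
  - apply/seteqP; split => // x [[_ xf] [_ xt]].
    by have := etrans (esym (xf : x p = false)) (xt : x p = true).
have mf (B : set cantorB) : measurable B -> measurable (flip p @^-1` B : set cantorB).
  by apply: measurable_preimage_continuous; exact: continuous_flip.
rewrite (split_mass A mA) (split_mass _ (mf _ mA)) addeC.
have flipp x : flip p x p = ~~ x p by rewrite /flip eqxx.
congr (_ + _).
  have mX : measurable (psi @` (A `&` Cb false)).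
    by apply: measurable_fat_image; exact: measurableI.
  apply: etrans (lebesgue_measure_shift (- fat_weight R p) mX).
  congr lebesgue_measure; apply/seteqP; split => r.
    move=> [x [Ax /= xp] <-]; exists (flip p x).
      by split => //=; rewrite /Cb /= flipp xp.
    rewrite -{2}(flipK p x) (@fat_cantor_flip R p (flip p x)) ?addrK //.
    by rewrite flipp xp.
  move=> [y [Ay yp] yr]; exists (flip p y).
    by split; rewrite /preimage /Cb /= ?flipK ?flipp ?yp.
  by rewrite fat_cantor_flip // yr subrK.
have mX : measurable (psi @` (A `&` Cb true)).
  by apply: measurable_fat_image; exact: measurableI.
apply: etrans (lebesgue_measure_shift (fat_weight R p) mX).
congr lebesgue_measure; apply/seteqP; split => r.
  move=> [x [Ax /= xp] <-]; exists (flip p x).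
    by split => //=; rewrite /Cb /= flipp xp.
  by rewrite fat_cantor_flip.
move=> [y [Ay yp] yr]; exists (flip p y).
  by split; rewrite /preimage /Cb /= ?flipK ?flipp ?yp.
apply: (addIr (fat_weight R p)); rewrite -yr -{2}(flipK p y) (@fat_cantor_flip R p (flip p y)) //.
by rewrite flipp yp.
Qed.

Definition cylinder (M : nat) (pi : nat -> nat) (t : nat -> bool) : set cantor_space :=
  [set x | forall i, (i < M)%N -> x (pi i) = t i].

Lemma continuous_reindex (pi : nat -> nat) :
  continuous (fun x : cantor_space => (fun n => x (pi n)) : cantor_space).
Proof. by apply: continuous_into_prod => i; exact: continuous_coord. Qed.

Lemma measurable_cylinder M pi t : measurable (cylinder M pi t : set cantorB).
Proof.
have mM : measurable ([set y : cantor_space | forall i, (i < M)%N -> y i = t i] : set cantorB).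
  apply: (@prefix_set_measurable M) => x y xy Hx i iM.
  by rewrite -xy // Hx.
exact: (measurable_preimage_continuous (@continuous_reindex pi) mM).
Qed.

(** Flipping bit [pi M] exchanges the two halves of a cylinder, and by injectivity of [pi] it
    respects the earlier constraints; so each new constraint halves the mass. *)
Lemma cylinder_mass (M : nat) (pi : nat -> nat) (t : nat -> bool) :
  injective pi ->
  mu (cylinder M pi t) = (2^-1 ^+ M * fine (mu setT))%:E.
Proof.
move=> ipi; elim: M => [|M IHM].
  rewrite expr0 mul1r fineK ?ge0_fin_numE ?fat_mass_lty ?measure_ge0 //.
  by congr fat_mass; apply/seteqP; split.
pose D b := cylinder M pi t `&` [set x : cantor_space | x (pi M) = b].
have mD b : measurable (D b : set cantorB).
  apply: measurableI; first exact: measurable_cylinder.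
  exact: prefix_set_measurable (@prefix_set_coord (pi M) b).
have DE : cylinder M.+1 pi t = D (t M).
  apply/seteqP; split => [x Hx|x [Hx xM] i].
    by split => [i iM|]; apply: Hx => //; rewrite ltnS ltnW.
  by rewrite ltnS leq_eqVlt => /predU1P[->//|]; exact: Hx.
have DN : mu (D (~~ t M)) = mu (D (t M)).
  rewrite -(fat_mass_flip (pi M) (mD (t M))); congr fat_mass.
  have flipE (x : cantor_space) i : (i < M)%N -> flip (pi M) x (pi i) = x (pi i).
    by move=> iM; rewrite /flip (inj_eq ipi) ltn_eqF.
  have flipM (x : cantor_space) : flip (pi M) x (pi M) = ~~ x (pi M).
    by rewrite /flip eqxx.
  apply/seteqP; split => x [Hx /= xM]; split.
  - by move=> i iM; rewrite flipE // Hx.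
  - by rewrite /= flipM xM negbK.
  - by move=> i iM; rewrite -(flipE x i iM) Hx.
  - by move: xM; rewrite /= flipM => <-; rewrite negbK.
have : mu (cylinder M pi t) = mu (D (t M)) + mu (D (~~ t M)).
  rewrite -measureU //.
    congr fat_mass; apply/seteqP; split => [x Hx|x [[]//|[]//]].
    by case: (eqVneq (x (pi M)) (t M)) => [|/negPf] e; [left|right]; split => //=;
      move: e; case: (x _); case: (t M).
  apply/seteqP; split => // x [[_ xf] [_ xt]].
  have := etrans (esym (xf : x (pi M) = t M)) (xt : x (pi M) = ~~ t M).
  by case: (t M).
rewrite DN IHM -DE.
have fm : mu (cylinder M.+1 pi t) \is a fin_num.
  by rewrite ge0_fin_numE ?measure_ge0 // fat_mass_lty //; exact: measurable_cylinder.
rewrite -(fineK fm) -EFinD => -[h]; congr (_%:E); rewrite exprS.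
by rewrite -mulrA h; field.
Qed.

(** Distinct bits behave as independent fair coins: the set is a disjoint union of cylinders whose
    number and masses do not depend on the injection. *)
Lemma mass_reindex (M : nat) (Q : set cantor_space) (pi : nat -> nat) :
  prefix_set M Q -> injective pi ->
  mu [set x : cantor_space | Q (fun n => x (pi n))] = mu Q.
Proof.
move=> pQ ipi.
pose ext (s : {ffun 'I_M -> bool}) (n : nat) : bool :=
  if insub n is Some i then s i else false.
pose D := [set s : {ffun 'I_M -> bool} | Q (ext s)].
have extE (s : {ffun 'I_M -> bool}) (i : 'I_M) : ext s i = s i.
  by rewrite /ext valK.
have E (rho : nat -> nat) : injective rho ->
    mu [set x : cantor_space | Q (fun n => x (rho n))] =
    \sum_(s \in D) (2^-1 ^+ M * fine (mu setT))%:E.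
  move=> irho.
  have -> : [set x : cantor_space | Q (fun n => x (rho n))] =
      \bigcup_(s in D) cylinder M rho (ext s).
    apply/seteqP; split => [x Qx|x [s Qs Hx]].
      exists [ffun i : 'I_M => x (rho i)].
        apply: pQ Qx => i iM.
        by rewrite -[i in RHS]/(val (Ordinal iM)) extE ffunE.
      by move=> i iM; rewrite -[i in RHS]/(val (Ordinal iM)) extE ffunE.
    by apply: pQ Qs => i iM; rewrite -Hx.
  rewrite measure_fin_bigcup //.
  - apply: eq_fsbigr => s _; exact: cylinder_mass.
  - exact: finite_finset.
  - apply/trivIsetP => s s' _ _ /eqP ss'; apply/seteqP; split => // x [Hs Hs'].
    apply: ss'; apply/ffunP => i.
    by rewrite -!extE -(Hs i (ltn_ord i)) Hs'.
  - by move=> s _; exact: measurable_cylinder.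
by rewrite (E pi ipi); rewrite -(E id (fun x y => id)).
Qed.

(** The complement of the interior of [U] has a compact image missing [psi x], hence missing a ball
    around it; points sharing a long prefix with [x] are mapped into that ball. *)
Lemma cantor_nbhs_prefix (x : cantor_space) (U : set cantor_space) :
  nbhs x U -> exists n, forall y : cantor_space,
    (forall i, (i < n)%N -> x i = y i) -> U y.
Proof.
move=> /nbhs_interior xU.
have : closed (psi @` (~` U^°)).
  apply: compact_closed; first exact: Rhausdorff.
  by apply: compact_fat_image; rewrite closedC; exact: open_interior.
rewrite -openC => oN.
have : nbhs (psi x) (~` (psi @` (~` U^°))).
  apply: open_nbhs_nbhs; split => // -[y nUy /fat_cantor_inj yx].
  by apply: nUy; rewrite yx; exact: nbhs_singleton.
move=> /nbhs_ballP[e /= e0 xN].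
have [n _ Hn] := (cvgrPdist_lt _ _).1 (@fat_tail_cvg0 R) _ e0.
have := Hn n (leqnn n); rewrite /= sub0r normrN ger0_norm; last exact/ltW/fat_tail_gt0.
move=> te; exists n => y xy; apply: contrapT => nUy.
apply: (xN (psi y)); last by exists y => // /interior_subset.
by rewrite /ball /=; exact: le_lt_trans (fat_cantor_dist R xy) te.
Qed.

End mass.

(** * Null sets *)

Section null_sets.
Variable R : realType.
Local Open Scope ereal_scope.
Local Notation psi := (@fat_cantor R).
Local Notation mu := (@fat_mass R).
Local Notation lambda := (@lebesgue_measure R).

Lemma prefix_closure_closed (K : set cantor_space) : closed K ->
  \bigcap_n [set x : cantor_space |
    exists2 y : cantor_space, K y & forall i, (i < n)%N -> x i = y i] = K.
Proof.
move=> cK; apply/seteqP; split => [x Hx|x Kx n _]; last by exists x.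
apply: contrapT => nKx.
have : nbhs x (~` K) by apply: open_nbhs_nbhs; split => //; rewrite openC.
move=> /(@cantor_nbhs_prefix R)[n nKn].
by have [y Ky xy] := Hx n I; exact: (nKn y xy).
Qed.

(* Flipping a late coordinate barely moves a closed set, so a closed set that
   is disjoint from such flips of itself has at most half its own mass. *)
Lemma closed_flip_disjoint_null (K : set cantor_space) : closed K ->
  (forall L, exists2 p, (L <= p)%N & forall x, K x -> ~ K (flip p x)) ->
  mu K = 0.
Proof.
move=> cK fK.
pose F n := [set x : cantor_space |
  exists2 y : cantor_space, K y & forall i, (i < n)%N -> x i = y i].
have pF n : prefix_set n (F n).
  by move=> x y xy [z Kz xz]; exists z => // i i_n; rewrite -xy // xz.
have mF n : measurable (F n : set cantorB) by exact: prefix_set_measurable (pF n).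
have mK : measurable (K : set cantorB) by exact: closed_cantorB.
have FE : \bigcap_n F n = K by exact: prefix_closure_closed.
have cvgF : mu \o F @ \oo --> mu K.
  rewrite -[in X in _ --> X]FE; apply: nonincreasing_cvg_mu => //.
  - exact: fat_mass_lty.
  - by rewrite FE.
  - apply/nonincreasing_seqP => n; apply/subsetPset => x [y Ky xy].
    by exists y => // i i_n; apply: xy; exact: ltnW.
have le2 n : mu K + mu K <= mu (F n).
  have [p np dK] := fK n.
  have mfK : measurable (flip p @^-1` K : set cantorB).
    by apply: measurable_preimage_continuous => //; exact: continuous_flip.
  rewrite -[X in _ + X](fat_mass_flip R p mK) -measureU //; last first.
    by apply/seteqP; split => // x [Kx]; exact: dK.
  apply: le_measure; rewrite ?inE //; first exact: measurableU.
  move=> x [Kx|Kfx]; first by exists x.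
  by exists (flip p x) => // i i_n; rewrite /flip ltn_eqF // (leq_trans i_n).
have le2K : mu K + mu K <= mu K.
  rewrite -[leRHS](cvg_lim _ cvgF) //; apply: lime_ge; first exact: cvgP cvgF.
  exact: nearW.
have fm : mu K \is a fin_num.
  by rewrite ge0_fin_numE ?measure_ge0 // fat_mass_lty.
apply/eqP; rewrite eq_le measure_ge0 andbT.
by move: le2K; rewrite -(fineK fm) -EFinD !lee_fin -[X in (_ <= X)%R -> _]add0r lerD2r.
Qed.

(** Inner regularity reduces the claim to compact subsets of the image of [A]. Their preimages are
    closed subsets of [A], which inherit the disjointness from their flips. *)
Lemma flip_disjoint_negligible (A : set cantor_space) :
  lebesgue_measurable (psi @` A) ->
  (forall L, exists2 p, (L <= p)%N & forall x, A x -> ~ A (flip p x)) ->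
  lambda.-negligible (psi @` A).
Proof.
move=> [B [mB [N [mN N0 BN]]]] fA.
have BNA : B `\` N `<=` psi @` A.
  move=> r [Br nNr]; apply: contrapT => nAr; apply: nNr; apply: BN; by right.
have mBN : measurable (B `\` N) by exact: measurableD.
have BN0 : lambda (B `\` N) = 0.
  rewrite lebesgue_regularity_inner_sup //; apply/eqP; rewrite eq_le.
  apply/andP; split; last by apply: ereal_sup_ubound; exists set0; rewrite ?measure0;
    [split; [exact: compact0|] |].
  apply: ge_ereal_sup => _ [K [cK KBN] <-].
  have KE : psi @` (psi @^-1` K) = K.
    apply/seteqP; split => [_ [x Kx <-]//|r Kr].
    by have [x _ xr] := BNA _ (KBN _ Kr); exists x => //=; rewrite /preimage /= xr.
  rewrite -KE -[leLHS]/(mu (psi @^-1` K)) closed_flip_disjoint_null //.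
    apply: preimage_closed => [x _|]; first exact: continuous_fat_cantor.
    by apply: compact_closed => //; exact: Rhausdorff.
  move=> L; have [p Lp Hp] := fA L; exists p => // x Kx Kfx.
  have KA y : K (psi y) -> A y.
    by move=> /KBN /BNA [z Az /fat_cantor_inj <-].
  exact: (Hp x (KA _ Kx) (KA _ Kfx)).
have : lambda.-negligible ((B `\` N) `|` N).
  apply: negligibleU; first by exists (B `\` N); split.
  by exists N; split.
apply: negligibleS => r Ar; have [Nr|nNr] := pselect (N r); first by right.
left; split => //; apply: contrapT => nBr; apply: nNr; apply: BN; by left.
Qed.

Lemma negligible_open_cover (A : set cantor_space) (e : R) :
  lambda.-negligible (psi @` A) -> (0 < e)%R ->
  exists O : set cantor_space, [/\ open O, A `<=` O & mu O <= e%:E].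
Proof.
move=> /negligible_outer_measure A0 e0.
have [U [oU AU Ue]] := outer_measure_open_le (psi @` A) e0.
exists (psi @^-1` U); split.
- by apply: open_preimage_continuous => //; exact: continuous_fat_cantor.
- by move=> x Ax; apply: AU; exists x.
- rewrite A0 add0e in Ue; apply: le_trans Ue.
  apply: le_measure; rewrite ?inE.
  + apply: (@measurable_fat_image R); apply: open_cantorB.
    by apply: open_preimage_continuous => //; exact: continuous_fat_cantor.
  + exact: open_measurable.
  + by move=> _ [x Ux <-].
Qed.

(** The largest subset of [O] determined by the first [n] bits. *)
Definition prefix_interior (O : set cantor_space) (n : nat) : set cantor_space :=
  [set x | forall y : cantor_space, (forall i, (i < n)%N -> x i = y i) -> O y].

Lemma prefix_interior_prefix O n : prefix_set n (prefix_interior O n).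
Proof. by move=> x y xy Hx z yz; apply: Hx => i i_n; rewrite xy // yz. Qed.

Lemma prefix_interiorW O m n :
  (m <= n)%N -> prefix_interior O m `<=` prefix_interior O n.
Proof. by move=> mn x Hx y xy; apply: Hx => i im; apply: xy; exact: leq_trans mn. Qed.

Lemma bigcup_prefix_interior O : open O -> \bigcup_n prefix_interior O n = O.
Proof.
move=> oO; apply/seteqP; split => [x [n _ Hx]|x Ox]; first exact: Hx.
have [n Hn] := @cantor_nbhs_prefix R x O (open_nbhs_nbhs (conj oO Ox)).
by exists n.
Qed.

Lemma prefix_interior_mass (O : set cantor_space) (e : R) : open O -> (0 < e)%R ->
  exists n, mu (O `\` prefix_interior O n) <= e%:E.
Proof.
move=> oO e0.
have mO : measurable (O : set cantorB) by exact: open_cantorB.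
have mI n : measurable (prefix_interior O n : set cantorB).
  exact: prefix_set_measurable (@prefix_interior_prefix O n).
pose F n : set cantorB := O `\` prefix_interior O n.
have F0 : \bigcap_n F n = set0.
  apply/seteqP; split => // x Hx; have [Ox _] := Hx 0%N I.
  rewrite -(bigcup_prefix_interior oO) in Ox; case: Ox => n _ Hn.
  by have [] := Hx n I.
have mF n : measurable (F n) by exact: measurableD.
have : mu \o F @ \oo --> mu (\bigcap_n F n).
  apply: nonincreasing_cvg_mu => //.
  - exact: fat_mass_lty.
  - by rewrite F0.
  - apply/nonincreasing_seqP => n; apply/subsetPset => x [Ox nx]; split => //.
    by move=> Hx; apply: nx; exact: prefix_interiorW Hx.
rewrite F0 measure0 => /fine_cvgP[_ /cvgrPdist_lt /(_ _ e0)[n _ Hn]].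
have := Hn n (leqnn n); rewrite /= sub0r normrN ger0_norm ?fine_ge0 ?measure_ge0 //.
exists n; rewrite -[leLHS]fineK ?lee_fin; first exact: ltW.
by rewrite ge0_fin_numE ?measure_ge0 // (@fat_mass_lty R _ (mF n)).
Qed.

Lemma injective_unbounded (f : nat -> nat) (J : nat) :
  injective f -> exists j, (J <= f j)%N.
Proof.
move=> injf; apply: contrapT => nJ.
have lt j : (f j < J)%N by rewrite ltnNge; apply/negP => Jf; apply: nJ; exists j.
have : injective (fun j : 'I_J.+1 => Ordinal (lt j)).
  by move=> i j [/injf/val_inj].
by move=> /leq_card; rewrite !card_ord ltnn.
Qed.

(** Open covers [V j] of small mass are cut into clopen pieces [D (j, i)], the parts gained by
    successive approximations from inside. A point of [A] lies in one piece for every [j], hence in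
    infinitely many sets of an enumeration of all pieces. *)
Lemma negligible_limsup_cover (A : set cantor_space) (e : nat -> R) :
  lambda.-negligible (psi @` A) -> (forall p, (0 < e p)%R) ->
  exists (Q : nat -> set cantor_space) (M : nat -> nat),
  [/\ forall p, prefix_set (M p) (Q p),
      forall p, mu (Q p) <= (e p)%:E
    & forall x, A x -> forall J, exists2 p, (J <= p)%N & Q p x].
Proof.
move=> A0 e0.
have [V HV] : {V : nat -> set cantor_space & forall j,
    [/\ open (V j), A `<=` V j & mu (V j) <= (e (pickle (j, 0%N)))%:E]}.
  apply: (@choice _ _ (fun j V =>
    [/\ open V, A `<=` V & mu V <= (e (pickle (j, 0%N)))%:E])) => j.
  exact: negligible_open_cover.
have oV j : open (V j) by have [] := HV j.
have [n Hn] : {n : nat * nat -> nat & forall ji,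
    mu (V ji.1 `\` prefix_interior (V ji.1) (n ji)) <= (e (pickle ji))%:E}.
  apply: (@choice _ _ (fun (ji : nat * nat) n =>
    mu (V ji.1 `\` prefix_interior (V ji.1) n) <= (e (pickle ji))%:E)) => ji.
  exact: prefix_interior_mass.
(* The first term keeps what is missing from [V j] small; the second makes the depths unbounded, so
   that the approximations exhaust [V j]. *)
pose N ji := maxn (n ji) ji.2.
pose D (ji : nat * nat) : set cantor_space :=
  prefix_interior (V ji.1) (N (ji.1, ji.2.+1)) `\`
  (if ji.2 is 0 then set0 else prefix_interior (V ji.1) (N ji)).
pose Q p := if @pickle_inv (nat * nat)%type p is Some ji then D ji else set0.
pose L p := if @pickle_inv (nat * nat)%type p is Some ji then
  maxn (N (ji.1, ji.2.+1)) (N ji) else 0%N.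
have mI j k : measurable (prefix_interior (V j) k : set cantorB).
  exact: prefix_set_measurable (@prefix_interior_prefix (V j) k).
have mD ji : measurable (D ji : set cantorB).
  by apply: measurableD => //; case: (ji.2).
have Vsub j k : prefix_interior (V j) k `<=` V j by move=> x; exact.
exists Q, L; split.
- move=> p; rewrite /Q /L; case: pickle_inv => [[j i]|] //=.
  have p1 : prefix_set (maxn (N (j, i.+1)) (N (j, i))) (prefix_interior (V j) (N (j, i.+1))).
    by apply: prefix_setW (@prefix_interior_prefix _ _); exact: leq_maxl.
  have p2 : prefix_set (maxn (N (j, i.+1)) (N (j, i))) (prefix_interior (V j) (N (j, i))).
    by apply: prefix_setW (@prefix_interior_prefix _ _); exact: leq_maxr.
  move=> x y xy [Hx nx]; split; first exact: p1 xy Hx.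
  case: i p1 p2 xy Hx nx => // i p1 p2 xy Hx nx.
  by apply: (prefix_setC p2 xy).
- move=> p; rewrite /Q; case E : pickle_inv => [[j i]|]; last first.
    by rewrite measure0 lee_fin ltW.
  have <- : pickle (j, i) = p.
    by have := @pickle_invK (nat * nat)%type p; rewrite E.
  case: i E => [|i] E.
    have [_ _] := HV j; apply: le_trans.
    by apply: le_measure; rewrite ?inE //; [exact: open_cantorB|move=> x [/Vsub]].
  apply: le_trans (Hn (j, i.+1)).
  apply: le_measure; rewrite ?inE //.
    by apply: measurableD => //; exact: open_cantorB.
  move=> x [/Vsub Ox nx]; split => // Hx; apply: nx.
  by apply: prefix_interiorW Hx; exact: leq_maxl.
- move=> x Ax J.
  have [i Hi] : {i : nat -> nat & forall j, D (j, i j) x}.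
    apply: (@choice _ _ (fun j i => D (j, i) x)) => j.
    have [_ AV _] := HV j; have := AV _ Ax.
    rewrite -(bigcup_prefix_interior (oV j)) => -[k _ Hk].
    have exi : exists i, `[< prefix_interior (V j) (N (j, i.+1)) x >].
      exists k; apply/asboolP; apply: prefix_interiorW Hk.
      by rewrite /N /= leq_max leqnSn orbT.
    (* Minimality of [i] keeps the point out of the part that [D (j, i)] removes. *)
    have [i /asboolP Hi mini] := ex_minnP exi.
    exists i; split => //; case: i Hi mini => [_ _ []|i Hi mini Hx].
    have /mini : `[< prefix_interior (V j) (N (j, i.+1)) x >] by exact/asboolP.
    by rewrite ltnn.
  have [j Jj] : exists j, (J <= pickle (j, i j))%N.
    apply: injective_unbounded => j j' /(pcan_inj pickleK_inv) [].
    by [].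
  exists (pickle (j, i j)) => //.
  by rewrite /Q pickleK_inv.
Qed.

End null_sets.

(** * The random tree *)

Definition interleave (k : nat) (y : 'I_k.+1 -> cantor_space) : cantor_space :=
  fun n => y (inZp n) (n %/ k.+1).

Lemma separating_depth (k : nat) (z : 'I_k.+1 -> cantor_space) : injective z ->
  exists d, forall a b, a != b -> exists2 i, (i < d)%N & z a i <> z b i.
Proof.
move=> iz.
have [g Hg] : {g : 'I_k.+1 * 'I_k.+1 -> nat &
    forall ab, ab.1 != ab.2 -> z ab.1 (g ab) <> z ab.2 (g ab)}.
  apply: (@choice _ _ (fun (ab : 'I_k.+1 * 'I_k.+1) i =>
    ab.1 != ab.2 -> z ab.1 i <> z ab.2 i)) => -[a b] /=.
  have [->|ab] := eqVneq a b; first by exists 0%N.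
  apply: contrapT => nab; move/eqP: ab; apply; apply: iz; apply: funext => i.
  by apply: contrapT => zi; apply: nab; exists i.
exists (\max_(ab : 'I_k.+1 * 'I_k.+1) g ab).+1 => a b ab.
by exists (g (a, b)); [rewrite ltnS; exact: leq_bigmax|exact: (Hg (a, b) ab)].
Qed.

Section random_tree.
Variable R : realType.
Local Open Scope ereal_scope.
Local Notation psi := (@fat_cantor R).
Local Notation mu := (@fat_mass R).
Local Notation lambda := (@lebesgue_measure R).

(* The label of a node of the tree is a bit of the random real: the bit [l] of the
   point on the branch [z] is labelled by the initial segment of [z] of length
   [h l], so that [h] controls how fast the tree branches. *)
Definition node := (nat + seq bool * nat)%type.

Definition branch_node (h : nat -> nat) (z : cantor_space) (l : nat) : node :=
  inr ([seq z i | i <- iota 0 (h l)], l).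

Definition branch_point (h : nat -> nat) (x z : cantor_space) : cantor_space :=
  fun l => x (pickle (branch_node h z l)).

(* Below [c] the branches of the tuple may still share labels; replacing these by
   fresh ones makes the labelling injective, so that the tuple is distributed as
   a random real, and changes only finitely many of its bits. *)
Definition tuple_label (k : nat) (h : nat -> nat) (c : nat)
    (z : 'I_k.+1 -> cantor_space) (n : nat) : nat :=
  pickle (if (n < c)%N then inl n : node
          else branch_node h (z (inZp n)) (n %/ k.+1)).

Lemma continuous_branch_point h x : continuous (branch_point h x).
Proof.
apply: continuous_into_prod => l; apply/continuousP => A _.
apply: (@prefix_set_open (h l)) => z z' zz'; rewrite /= /branch_point /branch_node.
suff -> : [seq z i | i <- iota 0 (h l)] = [seq z' i | i <- iota 0 (h l)] by [].
by apply/eq_in_map => i; rewrite mem_iota => /andP[_]; exact: zz'.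
Qed.

(** From [c] on, a label contains a prefix long enough to identify the branch, hence [n] modulo
    [k.+1], and it also records the quotient. *)
Lemma tuple_label_inj k h c z d :
  (forall n, (c <= n)%N -> (d <= h (n %/ k.+1))%N) ->
  (forall a b, a != b -> exists2 i, (i < d)%N & z a i <> z b i) ->
  injective (@tuple_label k h c z).
Proof.
move=> hd zd m n /(pcan_inj pickleK).
case: ifPn => mc; case: ifPn => nc //; first by case.
rewrite -leqNgt in mc; rewrite -leqNgt in nc.
move=> [] zz mn.
have mod_eq : (inZp m : 'I_k.+1) = inZp n.
  apply: contrapT => /eqP /zd[i id]; apply.
  have ih : (i < h (m %/ k.+1))%N by exact: leq_trans id (hd m mc).
  have := congr1 (fun s => nth false s i) zz.
  by rewrite -mn !(nth_map 0%N) ?size_iota // nth_iota // add0n.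
have := congr1 val mod_eq; rewrite /= => mm.
by rewrite (divn_eq m k.+1) (divn_eq n k.+1) mn mm.
Qed.

(** Take for [h] the inverse of a strictly increasing function [N] above [M]: [h l] is the least [i]
    with [l < N i]. *)
Lemma slow_growth (M : nat -> nat) : exists h : nat -> nat,
  (forall i l, (l < M i)%N -> (h l <= i)%N) /\
  (forall d, exists c, forall l, (c <= l)%N -> (d <= h l)%N).
Proof.
pose N i := (\sum_(0 <= j < i.+1) (M j).+1)%N.
have MN i : (M i < N i)%N.
  by rewrite /N big_nat_recr //= addnS ltnS leq_addl.
have Nmono i j : (i <= j)%N -> (N i <= N j)%N.
  move=> /subnKC <-; elim: (j - i)%N => [|s]; first by rewrite addn0.
  by move=> /leq_trans; apply; rewrite addnS /N [leqRHS]big_nat_recr //= leq_addr.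
have Ni i : (i < N i)%N.
  by elim: i => [|i IHi]; rewrite /N big_nat_recr //= -/(N _) addnS ltnS ?leq_addr //;
    apply: leq_trans IHi _; rewrite leq_addr.
have exN l : exists i, (l < N i)%N by exists l.
exists (fun l => ex_minn (exN l)); split => [i l lM|d].
  by case: ex_minnP => j _; apply; exact: ltn_trans lM (MN i).
exists (N d) => l dl; case: ex_minnP => j lj _.
rewrite leqNgt; apply/negP => /ltnW /Nmono jd.
by have := leq_trans lj (leq_trans jd dl); rewrite ltnn.
Qed.

(** One real [x] outside countably many null sets serves all tuples. These are sorted by a depth [d]
    that separates their points and by the pattern [s] of their first [p] bits, which leaves
    finitely many events for each [d] and [p]. *)
Lemma random_tree (k : nat) (A : set cantor_space) :
  lambda.-negligible (psi @` A) ->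
  (forall c (x y : cantor_space), (forall n, (c <= n)%N -> x n = y n) -> A x -> A y) ->
  exists2 Phi : cantor_space -> cantor_space, continuous Phi &
    forall z : 'I_k.+1 -> cantor_space, injective z ->
      ~ A (interleave (fun a => Phi (z a))).
Proof.
move=> A0 tailA.
pose S p := {ffun 'I_k.+1 * 'I_p -> bool}.
pose card_S p := size (finmap.enum_fset (fset_set [set: S p])).
(* Summed over all patterns in [S p], this is at most [1 / 2 ^ p.+1], a summable bound; the
   successor makes the denominator visibly positive. *)
pose e p : R := ((card_S p).+1%:R^-1 * (1 / (2 ^ p.+1)%:R))%R.
have e0 p : (0 < e p)%R.
  by rewrite /e mulr_gt0 ?divr_gt0 ?invr_gt0 ?ltr0n ?expn_gt0.
have [Q [M [pQ Qe QA]]] := negligible_limsup_cover A0 e0.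
have [h [hM hd]] := slow_growth M.
have {}hd d : exists c, forall n, (c <= n)%N -> (d <= h (n %/ k.+1))%N.
  have [c Hc] := hd d; exists (c * k.+1)%N => n cn; apply: Hc.
  by rewrite leq_divRL.
have [c Hc] := choice hd.
pose sep d (z : 'I_k.+1 -> cantor_space) :=
  forall a b, a != b -> exists2 i, (i < d)%N & z a i <> z b i.
pose E d p (s : S p) : set cantor_space := [set x |
  exists z, [/\ sep d z, forall a (i : 'I_p), z a i = s (a, i)
    & Q p (fun n => x (tuple_label h (c d) z n))]].
have EP d p (s : S p) : E d p s = set0 \/ exists2 z, sep d z &
    E d p s = [set x | Q p (fun n => x (tuple_label h (c d) z n))].
  have [[z [dz sz]]|nz] := pselect (exists z, sep d z /\
      forall a (i : 'I_p), z a i = s (a, i)); last first.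
    left; apply/seteqP; split => // x [z [dz sz _]].
    by apply: nz; exists z.
  (* All tuples with pattern [s] give the same event: the set [Q p] reads only bits below [M p], and
     by the choice of [h] their labels involve at most [p] bits of each branch. *)
  right; exists z => //; apply/seteqP; split => [x [z' [dz' sz' Qx]]|x Qx].
    apply: (pQ p) Qx => n nM.
    rewrite /tuple_label; case: ifP => // _; rewrite /branch_node.
    suff -> : [seq z' (inZp n) i | i <- iota 0 (h (n %/ k.+1))] =
              [seq z (inZp n) i | i <- iota 0 (h (n %/ k.+1))] by [].
    apply/eq_in_map => i; rewrite mem_iota add0n => /andP[_ ih].
    have ip : (i < p)%N.
      by apply: leq_trans ih _; apply: hM; exact: leq_ltn_trans (leq_div _ _) nM.
    by rewrite -[i]/(val (Ordinal ip)) sz sz'.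
  by exists z.
have Emeas d p s : measurable (E d p s : set cantorB).
  have [->//|[z _ ->]] := EP d p s.
  have mQ : measurable (Q p : set cantorB) by exact: prefix_set_measurable (pQ p).
  exact: (measurable_preimage_continuous
    (@continuous_reindex (tuple_label h (c d) z)) mQ).
have Emass d p s : mu (E d p s) <= (e p)%:E.
  have [->|[z dz ->]] := EP d p s; first by rewrite measure0 lee_fin ltW.
  by rewrite (@mass_reindex R (M p)) //; exact: tuple_label_inj (Hc d) dz.
pose F d p : set cantorB := \bigcup_(s in [set: S p]) E d p s.
have mF d p : measurable (F d p).
  by apply: fin_bigcup_measurable => //; exact: finite_finset.
have Fmass d p : mu (F d p) <= (1 / (2 ^ p.+1)%:R)%:E.
  have fS : finite_set [set: S p] by exact: finite_finset.
  have sub : mu (F d p) <= \sum_(s \in [set: S p]) mu (E d p s).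
    by apply: content_sub_fsum => //; exact: mF.
  apply: (le_trans sub).
  have {sub}le : \sum_(s \in [set: S p]) mu (E d p s) <= \sum_(s \in [set: S p]) (e p)%:E.
    by rewrite !fsbig_finite //; apply: lee_sum => s _; exact: Emass.
  apply: (le_trans le); rewrite fsbig_finite // sumEFin lee_fin.
  rewrite big_const_seq count_predT iter_addr_0.
  rewrite -[size _]/(card_S p) -(mulr_natl (e p)) /e.
  set d2 := (1 / _)%R; rewrite mulrA; apply: ler_piMl; first by rewrite divr_ge0.
  by rewrite ler_pdivrMr ?mul1r ?ler_nat ?ltr0n.
(* This is the Borel-Cantelli lemma. *)
have lim0 d : mu (lim_sup_set (F d)) = 0.
  apply: lim_sup_set_cvg0 => //.
  apply: (@le_lt_trans _ _ (\sum_(p <oo) (1 / (2 ^ p.+1)%:R : R)%:E)).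
    by apply: lee_nneseries => [p _ _|p _]; [exact: measure_ge0|exact: Fmass].
  by apply: le_lt_trans (epsilon_trick0 xpredT ler01) _; exact: ltry.
pose B := \bigcup_d lim_sup_set (F d).
have mB : measurable (B : set cantorB).
  apply: bigcupT_measurable => d.
  by apply: bigcapT_measurable => n; apply: bigcup_measurable => p _; exact: mF.
have neglB : mu.-negligible B.
  apply: negligible_bigcup => d; exists (lim_sup_set (F d)); split => //.
    by apply: bigcapT_measurable => n; apply: bigcup_measurable => p _; exact: mF.
  exact: lim0.
have massB : mu B = 0 by exact: measure_negligible mB neglB.
have [x nBx] : exists x, ~ B x.
  apply: contrapT => nx.
  have BT : B = setT.
    by apply/seteqP; split => // x _; apply: contrapT => nBx; apply: nx; exists x.
  have : 0 < mu B by rewrite BT; exact: fat_mass_gt0.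
  by rewrite massB ltxx.
exists (branch_point h x); first exact: continuous_branch_point.
move=> z iz Az; apply: nBx.
have [d dz] := separating_depth iz.
exists d => // J _.
(* The relabelled tuple differs from the true one only below [c d], so it stays in [A]. *)
have Aw : A (fun n => x (tuple_label h (c d) z n)).
  apply: (tailA (c d)) Az => n cn.
  by rewrite /tuple_label ltnNge cn.
have [p Jp Qp] := QA _ Aw J.
exists p => //; exists [ffun ai : 'I_k.+1 * 'I_p => z ai.1 ai.2] => //.
by exists z; split => // a i; rewrite ffunE.
Qed.

End random_tree.

(** * Perfect free sets *)

Lemma closed_coincidence (R : realType) (T : topologicalType) (g h : T -> R) :
  continuous g -> continuous h -> closed [set x | g x = h x].
Proof.
move=> cg ch.
have -> : [set x | g x = h x] = (fun x => g x - h x)%R @^-1` [set 0%R].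
  apply/seteqP; split => x; rewrite /preimage /=; first by move=> ->; rewrite subrr.
  by move=> /eqP; rewrite subr_eq0 => /eqP.
apply: preimage_closed => [x _|]; last exact: closed_eq.
by apply: cvgB; [exact: cg|exact: ch].
Qed.

(** * Finite modifications of coded tuples *)

Section overwriting.

Definition overwrite (t : seq bool) (x : cantor_space) : cantor_space :=
  fun n => if (n < size t)%N then nth false t n else x n.

Definition coord (k : nat) (a : 'I_k.+1) (x : cantor_space) : cantor_space :=
  fun l => x (l * k.+1 + a)%N.

Lemma continuous_overwrite t : continuous (overwrite t).
Proof.
apply: continuous_into_prod => n; rewrite /overwrite; case: (n < size t)%N.
  by move=> x; exact: cvg_cst.
exact: continuous_coord.
Qed.

Lemma continuous_coord_cantor k a : continuous (@coord k a).
Proof. by apply: continuous_into_prod => l; exact: continuous_coord. Qed.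

Lemma overwrite_nil x : overwrite [::] x = x.
Proof. by []. Qed.

Lemma coord_interleave k (y : 'I_k.+1 -> cantor_space) a : coord a (interleave y) = y a.
Proof.
apply: funext => l; rewrite /coord /interleave divnMDl // (divn_small (ltn_ord a)) addn0.
have -> // : inZp (l * k.+1 + a) = a.
by apply: val_inj; rewrite /= modnMDl modn_small.
Qed.

(** The new prefix copies the overwritten point far enough to cover both [t] and the first [c]
    bits. *)
Lemma overwrite_tail (t : seq bool) (c : nat) (x y : cantor_space) :
  (forall n, (c <= n)%N -> x n = y n) -> exists t', overwrite t' y = overwrite t x.
Proof.
move=> xy; exists (mkseq (overwrite t x) (maxn (size t) c)); apply: funext => n.
rewrite {1}/overwrite size_mkseq; case: ltnP => nc; first by rewrite nth_mkseq.
move: nc; rewrite geq_max => /andP[tn cn].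
by rewrite /overwrite ltnNge tn /= xy.
Qed.

Lemma coord_overwrite_flip k (t : seq bool) (a : 'I_k.+1) (l : nat) (x : cantor_space) :
  (size t <= l)%N ->
  (forall b, b != a -> coord b (overwrite t (flip (l * k.+1 + a) x)) =
    coord b (overwrite t x)) /\
  coord a (overwrite t (flip (l * k.+1 + a) x)) <> coord a (overwrite t x).
Proof.
move=> tl; split => [b ba|].
  apply: funext => i; rewrite /coord /overwrite /flip.
  case: ifP => // _; case: eqP => // /eqP e.
  have := congr1 (modn^~ k.+1) (eqP e); rewrite !modnMDl !modn_small // => /val_inj ab.
  by rewrite ab eqxx in ba.
move=> /(congr1 (fun u : cantor_space => u l)); rewrite /coord /overwrite.
rewrite ltnNge (leq_trans tl) ?(leq_trans _ (leq_addr _ _)) ?leq_pmulr //=.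
by rewrite /flip eqxx; case: (x _).
Qed.

Lemma extend_uniq (w : seq cantor_space) (n : nat) : uniq w -> (size w <= n)%N ->
  exists w', [/\ uniq w', size w' = n & {subset w <= w'}].
Proof.
move=> uw wn; rewrite -(subnKC wn); elim: (n - size w)%N => [|d [w' [uw' sw' ww']]].
  by exists w; split; rewrite ?addn0.
(* The diagonal argument yields a point outside the list. *)
pose x : cantor_space := fun i => ~~ nth point w' i i.
exists (x :: w'); split; rewrite /= ?sw' ?addnS //.
  rewrite uw' andbT; apply/negP => /(nthP point)[i _ xi].
  by have := congr1 (fun u : cantor_space => u i) xi; rewrite /x; case: (nth _ _ _ _).
by move=> y /ww' yw; rewrite inE yw orbT.
Qed.

End overwriting.

(** * From null sets of codes to a perfect free set *)

Section perfect_free.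
Variables (R : realType) (Y : topologicalType) (emb : cantor_space -> Y).
Hypotheses (hY : hausdorff_space Y) (cemb : continuous emb) (iemb : injective emb).
Variables (m : nat) (f : fpow Y m -> Y).
Local Notation psi := (@fat_cantor R).
Local Notation lambda := (@lebesgue_measure R).

(** Measurability is asked of such sets only, which suits both a condition on preimages under [f]
    and a condition on its graph. *)
Definition value_set (a : 'I_m -> cantor_space -> cantor_space)
    (b : cantor_space -> cantor_space) : set cantor_space :=
  [set x | f (fun i => emb (a i x)) = emb (b x)].

Hypothesis measurable_value_set : forall a b,
  (forall i, continuous (a i)) -> continuous b ->
  lebesgue_measurable (psi @` value_set a b).

(** The map [s] tells which coordinate of the code fills each argument of [f], so that repeated
    arguments are covered. *)
Let hit (t : seq bool) (s : {ffun 'I_m -> 'I_m.+1}) (j : 'I_m.+1) :=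
  value_set (fun i x => coord (s i) (overwrite t x)) (fun x => coord j (overwrite t x)).

(** Avoiding these coincidences will make the tree map injective. *)
Let diag (t : seq bool) (a b : 'I_m.+1) : set cantor_space :=
  [set x | coord a (overwrite t x) = coord b (overwrite t x)].

(** If on [A] the other coordinates determine coordinate [j], then flipping a single late bit of
    that coordinate leaves [A]. *)
Lemma flip_far k (t : seq bool) (j : 'I_k.+1) (A : set cantor_space) :
  (forall x x', A x -> A x' ->
     (forall b, b != j -> coord b (overwrite t x') = coord b (overwrite t x)) ->
     coord j (overwrite t x') = coord j (overwrite t x)) ->
  forall L, exists2 p, (L <= p)%N & forall x, A x -> ~ A (flip p x).
Proof.
(* This is bit [L + size t] of coordinate [j], out of reach of the overwriting. *)
move=> HA L; exists ((L + size t) * k.+1 + j)%N.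
  by rewrite (leq_trans _ (leq_addr _ _)) // (leq_trans (leq_addr (size t) L)) // leq_pmulr.
move=> x Ax Afx.
have [same diff] := @coord_overwrite_flip k t j (L + size t) x (leq_addl _ _).
by apply: diff; exact: HA.
Qed.

(** As [j] is not in the range of [s], changing coordinate [j] alone preserves the arguments of [f],
    and the value then fixes that coordinate. *)
Lemma hit_negligible t (s : {ffun 'I_m -> 'I_m.+1}) j : (forall i, s i != j) ->
  lambda.-negligible (psi @` hit t s j).
Proof.
move=> sj; apply: flip_disjoint_negligible.
  apply: measurable_value_set => [i|];
    by apply: continuous_compose; [exact: continuous_overwrite|exact: continuous_coord_cantor].
apply: (@flip_far m t j) => x x' Hx Hx' same; apply: iemb.
rewrite -Hx -Hx'; congr f; apply: functional_extensionality_dep => i.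
by congr emb; exact: same.
Qed.

Lemma diag_negligible t a b : a != b -> lambda.-negligible (psi @` diag t a b).
Proof.
move=> ab; apply: flip_disjoint_negligible.
  exists (psi @` diag t a b); split; last first.
    by rewrite setDv setU0; exact: negligible_set0.
  apply: compact_measurable; apply: compact_fat_image.
  have cc (c : 'I_m.+1) : continuous (fun x => coord c (overwrite t x)).
    by apply: continuous_compose; [exact: continuous_overwrite|exact: continuous_coord_cantor].
  have -> : diag t a b =
      [set x | psi (coord a (overwrite t x)) = psi (coord b (overwrite t x))].
    by apply/seteqP; split => [x /= ->//|x /fat_cantor_inj].
  apply: closed_coincidence.
    exact: (continuous_compose (cc a) (@continuous_fat_cantor R)).
  exact: (continuous_compose (cc b) (@continuous_fat_cantor R)).
apply: (@flip_far m t b) => x x' Hx Hx' same.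
by rewrite -Hx -Hx' same.
Qed.

(** Quantifying over all [t] closes the set under finite modifications, as [random_tree] demands,
    and still leaves a countable union of null sets. *)
Let bad : set cantor_space := [set x | exists t,
  (exists (s : {ffun 'I_m -> 'I_m.+1}) j, (forall i, s i != j) /\ hit t s j x) \/
  (exists a b, a != b /\ diag t a b x)].

Lemma bad_tail c (x y : cantor_space) :
  (forall n, (c <= n)%N -> x n = y n) -> bad x -> bad y.
Proof.
move=> xy [t Ht]; have [t' E] := overwrite_tail t xy; exists t'.
by move: Ht; rewrite /hit /value_set /diag /= E.
Qed.

Lemma negligible_countable (T : countType) (F : T -> set cantor_space) :
  (forall i, lambda.-negligible (psi @` F i)) ->
  lambda.-negligible (psi @` (\bigcup_i F i)).
Proof.
move=> F0.
pose G n := if @unpickle T n is Some i then psi @` F i else set0.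
have : lambda.-negligible (\bigcup_n G n).
  apply: negligible_bigcup => n; rewrite /G; case: unpickle => [i|].
    exact: F0.
  exact: negligible_set0.
apply: negligibleS => _ [x [i _ Fx] <-].
by exists (pickle i) => //; rewrite /G pickleK; exists x.
Qed.

Lemma bad_negligible : lambda.-negligible (psi @` bad).
Proof.
pose F1 (u : seq bool * {ffun 'I_m -> 'I_m.+1} * 'I_m.+1) : set cantor_space :=
  [set x | (forall i, u.1.2 i != u.2) /\ hit u.1.1 u.1.2 u.2 x].
pose F2 (u : seq bool * 'I_m.+1 * 'I_m.+1) : set cantor_space :=
  [set x | u.1.2 != u.2 /\ diag u.1.1 u.1.2 u.2 x].
have N1 : lambda.-negligible (psi @` (\bigcup_u F1 u)).
  apply: negligible_countable => -[[t s] j].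
  have [sj|nsj] := pselect (forall i, s i != j).
    by apply: negligibleS (hit_negligible t sj) => _ [x [_ Hx] <-]; exists x.
  by apply: negligibleS (negligible_set0 _) => r [x [sj _] _]; case: nsj.
have N2 : lambda.-negligible (psi @` (\bigcup_u F2 u)).
  apply: negligible_countable => -[[t a] b].
  have [->|ab] := eqVneq a b.
    by apply: negligibleS (negligible_set0 _) => r [x [/=]]; rewrite eqxx.
  by apply: negligibleS (diag_negligible t ab) => _ [x [_ Hx] <-]; exists x.
apply: negligibleS (negligibleU N1 N2) => _ [x [t [[s [j Hx]]|[a [b Hx]]]] <-].
  by left; exists x => //; exists (t, s, j).
by right; exists x => //; exists (t, a, b).
Qed.

Lemma perfect_free : (0 < m)%N -> has_perfect_free_subset f.
Proof.
move=> m0.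
have [Phi cPhi HPhi] := random_tree m bad_negligible bad_tail.
(* Short lists of branches are padded to exactly [m.+1] distinct ones. *)
have tupleP (w : seq cantor_space) : uniq w -> (size w <= m.+1)%N ->
    exists (z : 'I_m.+1 -> cantor_space),
      injective z /\ forall y, y \in w -> exists a, z a = y.
  move=> uw sw; have [w' [uw' sw' ww']] := extend_uniq uw sw.
  exists (fun a => nth point w' a); split => [a b|y /ww' yw].
    move=> /eqP; rewrite nth_uniq ?sw' ?ltn_ord // => /eqP ab.
    exact: val_inj.
  have iw : (index y w' < m.+1)%N by rewrite -sw' index_mem.
  by exists (Ordinal iw); rewrite /= nth_index.
have iPhi : injective Phi.
  move=> y z yz; apply: contrapT => /eqP nyz.
  have [|//|w [iw /= Hw]] := tupleP [:: y; z]; first by rewrite /= inE nyz.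
  have [a wa] := Hw y (mem_head _ _).
  have [b wb] : exists b, w b = z by apply: Hw; rewrite !inE eqxx orbT.
  apply: (HPhi w iw); exists [::]; right; exists a, b; split.
    by apply: contraNneq nyz => ab; rewrite -wa -wb ab.
  by rewrite /diag /= overwrite_nil !coord_interleave wa wb.
pose e z := emb (Phi z).
have ce : continuous e by exact: continuous_compose.
have ie : injective e by move=> y z /iemb /iPhi.
exists (range e); split.
- by exists (e point); exists point.
- apply: compact_closed => //; apply: continuous_compact.
    exact: continuous_subspaceT.
  exact: cantor_space_compact.
- apply/seteqP; split => // y.
  move=> [/set_mem[z _ <-] [V nV eV]].
  have : nbhs z (e @^-1` V) by exact: ce.
  move=> /(@cantor_nbhs_prefix R)[n Hn].
  (* Flipping a late bit of the branch gives a second point of the range in [V]. *)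
  have Vfz : V (e (flip n z)).
    by apply: Hn => i i_n; rewrite /flip ltn_eqF.
  have : (V `&` range e) (e (flip n z)) by split => //; exists (flip n z).
  rewrite eV => /ie /(congr1 (fun u : cantor_space => u n)).
  by rewrite /flip eqxx; case: (z n).
- move=> a Pa; have [Pfa|] := pselect (range e (f a)); last by right.
  left; apply: contrapT => nfa.
  have [za Hza] : {za : 'I_m -> cantor_space & forall i, e (za i) = a i}.
    by apply: (@choice _ _ (fun i z => e z = a i)) => i; have [z _ <-] := Pa i; exists z.
  have [zb _ Hzb] := Pfa.
  (* The arguments may repeat, so duplicates are dropped; with the value, at most [m.+1] branches
     remain. *)
  pose w := undup (zb :: [seq za i | i <- enum 'I_m]).
  have [||z [iz Hz]] := tupleP w; first exact: undup_uniq.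
    by apply: leq_trans (size_undup _) _; rewrite /= size_map size_enum_ord.
  have [s Hs] : {s : 'I_m -> 'I_m.+1 & forall i, z (s i) = za i}.
    apply: (@choice _ _ (fun i b => z b = za i)) => i; apply: Hz.
    by rewrite mem_undup inE map_f ?orbT // mem_enum.
  have [j Hj] : exists j, z j = zb by apply: Hz; rewrite mem_undup mem_head.
  apply: (HPhi z iz); exists [::]; left; exists (finfun s), j; split.
    move=> i; rewrite ffunE; apply/eqP => sij; apply: nfa; exists i.
    by rewrite -Hzb -Hza -Hs sij Hj.
  rewrite /hit /value_set /= overwrite_nil coord_interleave Hj -[RHS]/(e zb) Hzb; congr f.
  apply: functional_extensionality_dep => i.
  by rewrite ffunE coord_interleave Hs -Hza.
Qed.

End perfect_free.

(** * Measurability of images in the reals *)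

Section lebesgue_measurable_sets.
Variable R : realType.
Local Notation psi := (@fat_cantor R).
Local Notation lambda := (@lebesgue_measure R).

Lemma measurable_lebesgue_measurable (A : set R) :
  measurable A -> lebesgue_measurable A.
Proof.
by move=> mA; exists A; split => //; rewrite setDv setU0; exact: negligible_set0.
Qed.

Lemma lebesgue_measurableC (A : set R) :
  lebesgue_measurable A -> lebesgue_measurable (~` A).
Proof.
move=> [B [mB NB]]; exists (~` B); split; first exact: measurableC.
by apply: negligibleS NB => r; rewrite !setDE !setCK => -[[? ?]|[? ?]]; [right|left].
Qed.

Lemma lebesgue_measurable_bigcap (A : nat -> set R) :
  (forall l, lebesgue_measurable (A l)) -> lebesgue_measurable (\bigcap_l A l).
Proof.
move=> /choice[B HB]; exists (\bigcap_l B l); split.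
  by apply: bigcapT_measurable => l; have [] := HB l.
have : lambda.-negligible (\bigcup_l ((A l `\` B l) `|` (B l `\` A l))).
  by apply: negligible_bigcup => l; have [] := HB l.
apply: negligibleS => r [[Hr nr]|[Hr nr]].
  have [l nl] : exists l, ~ B l r.
    by apply: contrapT => nex; apply: nr => l _; apply: contrapT => nl; apply: nex; exists l.
  by exists l => //; left; split => //; exact: Hr.
have [l nl] : exists l, ~ A l r.
  by apply: contrapT => nex; apply: nr => l _; apply: contrapT => nl; apply: nex; exists l.
by exists l => //; right; split => //; exact: Hr.
Qed.

Lemma lebesgue_measurableI (A B : set R) :
  lebesgue_measurable A -> lebesgue_measurable B -> lebesgue_measurable (A `&` B).
Proof.
move=> lA lB.
have -> : A `&` B = \bigcap_l (if l is 0 then A else B).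
  apply/seteqP; split => [r [Ar Br] [|l] _ //|r Hr].
  by split; [exact: (Hr 0%N I)|exact: (Hr 1%N I)].
by apply: lebesgue_measurable_bigcap => -[|l].
Qed.

Lemma closed_image_lebesgue_measurable (A : set cantor_space) :
  closed A -> lebesgue_measurable (psi @` A).
Proof.
move=> cA; apply: measurable_lebesgue_measurable.
by apply: compact_measurable; exact: compact_fat_image.
Qed.

(** Level 0 is separate: the image of a clopen set need not be clopen in the reals, but it is
    compact. *)
Lemma Delta1_image_lebesgue_measurable (n : nat) :
  (forall A : set R, Delta1 n A -> lebesgue_measurable A) ->
  forall A : set cantor_space, Delta1 n A -> lebesgue_measurable (psi @` A).
Proof.
case: n => [_ A /Delta1_clopen0[_ cA]|n Hn A DA].
  exact: closed_image_lebesgue_measurable.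
apply: Hn; apply: Delta1_image => //; first exact: continuous_fat_cantor.
exact: fat_cantor_inj.
Qed.

(** Above level 0, the image is the compact range minus the image of the complement, and the latter
    is a set to which the hypothesis applies. *)
Lemma Pi1_image_lebesgue_measurable (n : nat) :
  (forall A : set R, Sigma1 n A -> lebesgue_measurable A) ->
  forall A : set cantor_space, Pi1 n A -> lebesgue_measurable (psi @` A).
Proof.
case: n => [_ A|n Hn A PA].
  rewrite /Pi1 /= openC; exact: closed_image_lebesgue_measurable.
have -> : psi @` A = psi @` setT `&` ~` (psi @` (~` A)).
  apply/seteqP; split => [_ [x Ax <-]|_ [[x _ <-] nA]].
    by split; [exists x|move=> [y nAy /fat_cantor_inj yx]; apply: nAy; rewrite yx].
  by exists x => //; apply: contrapT => nAx; apply: nA; exists x.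
apply: lebesgue_measurableI.
  by apply: closed_image_lebesgue_measurable; exact: closedT.
apply: lebesgue_measurableC; apply: Hn; apply: Sigma1_image => //.
exact: continuous_fat_cantor.
Qed.

End lebesgue_measurable_sets.

Lemma clopen_Delta1 (n : nat) (X : topologicalType) (A : set X) :
  clopen A -> Delta1 n A.
Proof. by move=> cA; elim: n => [|n]; [exact/Delta1_clopen0|exact: Delta1_succ]. Qed.

(** Two bits agree when both or neither are true, which is a Boolean combination of preimages of one
    clopen set. *)
Lemma Delta1_eq_value (n m : nat) (f : fpow cantor_space m -> cantor_space)
    (a : 'I_m -> cantor_space -> cantor_space) (b : cantor_space -> cantor_space)
    (l : nat) :
  Delta1_fun n f -> (forall i, continuous (a i)) -> continuous b ->
  Delta1 n [set x | f (fun i => a i x) l = b x l].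
Proof.
move=> Df ca cb.
pose U : set cantor_space := [set y | y l = true].
have pU := @prefix_set_coord l true.
have cU : clopen U by split; [exact: prefix_set_open pU|exact: prefix_set_closed pU].
have DU : Delta1 n (b @^-1` U) by apply: Delta1_preimage => //; exact: clopen_Delta1.
pose g (x : cantor_space) : fpow cantor_space m := fun i => a i x.
have cg : continuous g by apply: continuous_into_prod.
have DV : Delta1 n (g @^-1` (f @^-1` U)).
  by apply: Delta1_preimage => //; apply: Df; case: cU.
set V := g @^-1` _ in DV.
have -> : [set x | f (fun i => a i x) l = b x l] =
    (V `&` b @^-1` U) `|` (~` V `&` ~` (b @^-1` U)).
  apply/seteqP; split => x; rewrite /V /U /g /preimage /=.
    by move=> ->; case: (b x l); [left|right].
  by move=> [[-> ->//]|[/negP + /negP]]; case: (f _ l); case: (b x l).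
by apply: Delta1U; apply: Delta1I => //; exact: Delta1C.
Qed.

Theorem theorem1p4 (R : realType) (n : nat) :
  ((forall A : set R, Delta1 n A -> lebesgue_measurable A) ->
     Delta1_PFS n) /\
  ((forall A : set R, Sigma1 n A -> lebesgue_measurable A) ->
     forall (m : nat), (1 <= m)%N ->
     forall f : fpow baire_space m -> baire_space,
       Pi1 n (fgraph_set f) -> has_perfect_free_subset f).
Proof.
split => [Hn m m1 f Df|Hn m m1 f Pf].
  have cid : continuous (id : cantor_space -> cantor_space) by move=> x; exact: cvg_id.
  apply: (@perfect_free R cantor_space id cantor_space_hausdorff cid _ m f _ m1) => //.
  move=> a b ca cb.
  (* Equality of points is the conjunction of the equalities of their bits. The countable
     intersection is taken among measurable sets, so only the single bits need the pointclass. *)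
  have -> : @fat_cantor R @` value_set id f a b =
      \bigcap_l (@fat_cantor R @` [set x | f (fun i => a i x) l = b x l]).
    apply/seteqP; split => [_ [x Hx <-] l _|r Hr].
      by exists x => //=; rewrite (Hx : f (fun i => a i x) = b x).
    have [x _ xr] := Hr 0%N I; exists x => //; apply: funext => l.
    by have [y Hy yr] := Hr l I; rewrite (fat_cantor_inj (etrans xr (esym yr))).
  apply: lebesgue_measurable_bigcap => l.
  by apply: (Delta1_image_lebesgue_measurable Hn); exact: Delta1_eq_value.
have hb : hausdorff_space baire_space.
  by apply: hausdorff_product => i; exact: discrete_hausdorff.
apply: (@perfect_free R baire_space cantor_baire hb continuous_cantor_baire
  (can_inj cantor_baireK) m f _ m1).
move=> a b ca cb; apply: (Pi1_image_lebesgue_measurable Hn).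
(* The value set is a continuous preimage of the graph, so it is of the same class. *)
pose g x : fpow baire_space m * baire_space :=
  (fun i => cantor_baire (a i x), cantor_baire (b x)).
have cg : continuous g.
  apply: continuous_pair; last first.
    by apply: continuous_compose => //; exact: continuous_cantor_baire.
  apply: continuous_into_prod => i.
  by apply: continuous_compose => //; exact: continuous_cantor_baire.
have -> : value_set cantor_baire f a b = g @^-1` fgraph_set f.
  by apply/seteqP; split => x; rewrite /value_set /fgraph_set /=.
exact: (Sigma1_preimage cg Pf).
Qed.
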